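(* Let $X:=W^{DT}_{(1,0)}$ and $Y:=W^{DT}_{(0,1)}$ be the elementary limits of a large two-color discrete time Pólya urn process with replacement matrix $\begin{pmatrix}a&b\\c&d\end{pmatrix}$, balance $S=a+b=c+d$ and ratio $\sigma>\frac12$. Then $X$ and $Y$ satisfy the system of distributional equations $$ \left\{ \begin{array}{l} \displaystyle X\overset{\mathcal L}{=}\sum_{k=1}^{a+1}V_k^{\sigma}X^{(k)}+\sum_{k=a+2}^{S+1}V_k^{\sigma}Y^{(k)}\\[2ex] \displaystyle Y\overset{\mathcal L}{=}\sum_{k=1}^{c}V_k^{\sigma}X^{(k)}+\sum_{k=c+1}^{S+1}V_k^{\sigma}Y^{(k)} \end{array} \right. $$ where (i) $V=(V_1,\dots,V_{S+1})$ is a Dirichlet distributed random vector with parameters $\left(\frac1S,\dots,\frac1S\right)$; (ii) the $X^{(k)}$ and the $Y^{(k)}$ are respective copies of $X$ and $Y$, all being independent of each other and of $V$.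
   Context: Standing assumptions on the urn: $a,b,c,d$ are nonnegative integers with $a+b=c+d=:S$ (balanced), $bc\neq0$ (non triangular), $m:=a-c=d-b$, $\sigma:=m/S$, and the urn is large, i.e. $\sigma>\frac12$. Discrete time urn: start with $\alpha$ red and $\beta$ black balls, $(\alpha,\beta)\in\mathbb N^2\setminus\{(0,0)\}$. At each time step a ball is drawn uniformly at random among the balls of the urn and put back; if it is red, $a$ red and $b$ black balls are added; if it is black, $c$ red and $d$ black balls are added. $U^{DT}_{(\alpha,\beta)}(n)\in\mathbb N^2$ is the composition vector (number of red balls, number of black balls) after $n$ draws. Let $u_2(x,y)=\frac1S(bx-cy)$. It is known that the limit $$W^{DT}_{(\alpha,\beta)}:=\lim_{n\to+\infty}\frac1{n^{\sigma}}u_2\left(U^{DT}_{(\alpha,\beta)}(n)\right)$$ exists almost surely and in $L^p$ for every $p\ge1$. $\overset{\mathcal L}{=}$ denotes equality in distribution. The Dirichlet distribution with positive parameters $(\nu_1,\dots,\nu_d)$ is the probability law on the simplex $\{x\in[0,1]^d:\sum_k x_k=1\}$ with density proportional to $\prod_{k=1}^d x_k^{\nu_k-1}$. *)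

(* Defs.v *)
From mathcomp Require Export all_boot all_order all_algebra.
From mathcomp Require Export all_classical all_reals all_analysis.

Set Implicit Arguments.
Unset Strict Implicit.
Unset Printing Implicit Defensive.

Import Order.TTheory GRing.Theory Num.Theory.
Import numFieldNormedType.Exports.

Local Open Scope classical_set_scope.
Local Open Scope ring_scope.

Section Urn.
Variables a b c d : nat.

(* Compositions are pairs (red, black); in a history of draws, [true] means
   that the ball drawn is red. *)
Definition urn_step (u : nat * nat) (red : bool) : nat * nat :=
  if red then ((u.1 + a)%N, (u.2 + b)%N) else ((u.1 + c)%N, (u.2 + d)%N).

Definition urn_composition (u0 : nat * nat) (s : seq bool) : nat * nat :=
  foldl urn_step u0 s.

Variables (R : realType) (dO : measure_display) (O : measurableType dO)
  (P : probability O R).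

Definition draw_history (draw : nat -> {RV P >-> bool}) (n : nat) (w : O)
    : seq bool := mkseq (fun i => draw i w) n.

(* Given the first [n] draws, the next ball is uniform among the balls of the
   urn, hence red with conditional probability red / (red + black).  This is
   written without division by the probability of the history, which may
   vanish. *)
Definition urn_draws (u0 : nat * nat) (draw : nat -> {RV P >-> bool}) : Prop :=
  forall (n : nat) (s : n.-tuple bool),
    let u := urn_composition u0 s in
    P [set w | draw_history draw n w = s /\ draw n w = true] =
    (P [set w | draw_history draw n w = s] *
       (u.1%:R / (u.1 + u.2)%:R)%:E)%E.

Definition urn_process (u0 : nat * nat) (draw : nat -> {RV P >-> bool})
    (n : nat) (w : O) : nat * nat :=
  urn_composition u0 (draw_history draw n w).

Definition u2 (u : nat * nat) : R :=
  (b%:R * u.1%:R - c%:R * u.2%:R) / (a + b)%:R.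

Definition urn_limit (sigma : R) (u0 : nat * nat)
    (draw : nat -> {RV P >-> bool}) (W : {RV P >-> R}) : Prop :=
  {ae P, forall w,
    (fun n : nat => u2 (urn_process u0 draw n w) / n%:R `^ sigma) @ \oo
      --> (W w : R)}.

End Urn.

(* The two laws are only compared on measurable sets: the values of a measure
   on other sets carry no meaning. *)
Definition eq_law (R : realType) (d1 d2 d' : measure_display)
    (T1 : measurableType d1) (T2 : measurableType d2) (T' : measurableType d')
    (P1 : probability T1 R) (P2 : probability T2 R)
    (X1 : T1 -> T') (X2 : T2 -> T') : Prop :=
  forall B : set T', measurable B ->
    pushforward P1 X1 B = pushforward P2 X2 B.

Definition sigma_generated (dO d' : measure_display) (O : measurableType dO)
    (T' : measurableType d') (Z : O -> T') : set (set O) :=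
  preimage_set_system [set: O] Z measurable.

Definition mutually_independent (R : realType) (dO : measure_display)
    (O : measurableType dO) (P : probability O R) (I : finType)
    (F : I -> set (set O)) : Prop :=
  forall (J : {set I}) (E : I -> set O),
    (forall i, i \in J -> F i (E i)) ->
    P (\bigcap_(i in [set` J]) E i) = (\prod_(i in J) P (E i))%E.

(* [None] is the index of the vector V, [Some (inl k)] that of X^(k) and
   [Some (inr k)] that of Y^(k). *)
Definition sigma_family (R : realType) (dO : measure_display)
    (O : measurableType dO) (n : nat) (V : O -> n.-tuple R)
    (X Y : 'I_n -> O -> R) (i : option ('I_n + 'I_n)) : set (set O) :=
  match i with
  | None => sigma_generated V
  | Some (inl k) => sigma_generated (X k)
  | Some (inr k) => sigma_generated (Y k)
  end.

(* For nonnegative measurable [f], this is by Tonelli the integral of [f]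
   with respect to the Lebesgue measure on R^n. *)
Fixpoint lebesgue_iterated (R : realType) (n : nat) :
    (n.-tuple R -> \bar R) -> \bar R :=
  match n with
  | 0%N => fun f => f [tuple]
  | n'.+1 => fun f =>
      (\int[lebesgue_measure]_(x in [set: R])
         lebesgue_iterated (fun t : n'.-tuple R => f [tuple of x :: t]))%E
  end.

Definition simplex (R : realType) (n : nat) : set (n.-tuple R) :=
  [set x | (forall i, 0 <= tnth x i <= 1) /\ \sum_(i < n) tnth x i = 1].

(* The simplex of R^(n+1) carries the n-dimensional Lebesgue measure of the
   chart (x_1, ..., x_n) |-> (x_1, ..., x_n, 1 - x_1 - ... - x_n). *)
Definition simplex_chart (R : realType) (n : nat) (x : n.-tuple R)
    : n.+1.-tuple R := [tuple of rcons x (1 - \sum_(i < n) tnth x i)].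

Definition dirichlet_weight (R : realType) (n : nat) (nu : 'I_n -> R)
    (x : n.-tuple R) : R := \prod_(i < n) tnth x i `^ (nu i - 1).

Definition dirichlet_law (R : realType) (n : nat) (nu : 'I_n.+1 -> R)
    (mu : set (n.+1.-tuple R) -> \bar R) : Prop :=
  (forall i, 0 < nu i) /\
  exists2 C : R, 0 < C &
    forall B : set (n.+1.-tuple R), measurable B ->
      mu B = (C%:E * lebesgue_iterated (fun x : n.-tuple R =>
        (\1_(@simplex R n.+1 `&` B) (simplex_chart x) *
         dirichlet_weight nu (simplex_chart x))%:E))%E.

(* Main.v *)
From HB Require Import structures.
Require Import Defs.
From mathcomp Require Import all_boot all_order all_algebra.
From mathcomp Require Import all_classical all_reals all_analysis.
From mathcomp Require Import measurable_realfun ring lra zify.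
Set Implicit Arguments.
Unset Strict Implicit.
Unset Printing Implicit Defensive.
Import Order.TTheory GRing.Theory Num.Theory.
Import numFieldNormedType.Exports.
Local Open Scope classical_set_scope.
Local Open Scope ring_scope.

(** The first draw from a single ball is forced. After it the urn holds [S + 1]
balls, of which [a + 1] (for a red start) or [c] (for a black start) are red.
Give each of these balls its own sub-urn, made of the balls that descend from
it. As the urn is balanced, the size of a sub-urn only depends on how often it
has been drawn. Hence the successive choices of a sub-urn form a Polya urn with
[S + 1] colours that ignores the red and black contents and, given these
choices, the sub-urns are independent copies of the urn started from one ball.
By exchangeability the choices are, conditionally on a Dirichlet vector [V] with
parameters [1 / S], independent draws of law [V]. So the [k]-th sub-urn is drawn
about [V_k * n] times in [n] steps and contributes [V_k ^ sigma] times its own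
limit at the scale [n ^ sigma].

The law of a limit is tested on [0,1]-valued Lipschitz functions [f], which
suffice to determine it ([eq_law_test]), so that everything is about means of
[f] of the rescaled urn; at a finite time these are the finite recursions
[urn_mean] ([urn_expectation]). The splitting into sub-urns is then an exact
identity, [urn_mean_forest], proved by induction on the number of draws: all it
asks of [V] is how its moments change when one exponent grows by one. For the
Dirichlet density, given as an iterated Lebesgue integral, this is
[dirichlet_moment_succ], a consequence of the recurrence of Beta integrals.
The outcome, [urn_mean_mixture], is that the mean of the urn is the expectation
of a multinomial mean with random weights [V].

For fixed weights [v], Chebyshev's inequality puts the multinomial counts near
[n * v] ([multinomial_mean_chebyshev]), and the independent sub-urns are
replaced one after the other by [v_k ^ sigma] times their limits, uniformly in
the number of draws ([urn_limit_uniform], [operator_product_close]). Dominated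
convergence in [V] and the independence of the copies
([integral_weighted_sum]) give the limit of the mean as the expectation of [f]
of the right-hand side of the equation, while the almost sure convergence of the
urn gives the expectation of [f] of its limit ([cvg_urn_mean]). *)

(** * Iterated Lebesgue integrals *)

Section IteratedIntegral.
Context {R : realType}.
Local Notation LI := (@lebesgue_iterated R _).
Local Open Scope ereal_scope.

Lemma lebesgue_iterated_ge0 n (f : n.-tuple R -> \bar R) : (forall t, 0 <= f t) -> 0 <= LI f.
Proof.
elim: n f => [|n IH] f f0 /=; first exact: f0.
by apply: integral_ge0 => x _; exact: IH.
Qed.

Lemma lebesgue_iterated0 n : LI (fun _ : n.-tuple R => 0) = 0.
Proof. by elim: n => [//|n IH] /=; apply: integral0_eq. Qed.

Lemma eq_lebesgue_iterated n (f g : n.-tuple R -> \bar R) : f =1 g -> LI f = LI g.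
Proof. by move=> fg; congr lebesgue_iterated; exact: funext. Qed.

(** The parameter [x] is what makes the induction work: the outermost variable
of integration joins it, and Tonelli's theorem integrates it out again. *)
Lemma measurable_lebesgue_iterated n d (T : measurableType d) (F : T -> n.-tuple R -> \bar R) :
  measurable_fun [set: T * n.-tuple R] (fun z : T * n.-tuple R => F z.1 z.2) ->
  (forall x t, 0 <= F x t) ->
  measurable_fun [set: T] (fun x => LI (F x)).
Proof.
elim: n d T F => [|n IH] d T F mF F0 /=.
  have -> : (fun x => F x [tuple]) =
      (fun z : T * 0.-tuple R => F z.1 z.2) \o (fun x => (x, [tuple])) by [].
  apply: measurableT_comp => //.
pose G (z : T * R) := LI (fun t : n.-tuple R => F z.1 [tuple of z.2 :: t]).
have mG : measurable_fun setT G.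
  apply: (IH _ (T * R)%type (fun z t => F z.1 [tuple of z.2 :: t])) => [|x t]; last exact: F0.
  have -> : (fun z : (T * R) * n.-tuple R => F z.1.1 [tuple of z.1.2 :: z.2]) =
     (fun z : T * n.+1.-tuple R => F z.1 z.2) \o
     (fun z : (T * R) * n.-tuple R => (z.1.1, [tuple of z.1.2 :: z.2])) by [].
  apply: measurableT_comp => //.
  apply: measurable_fun_pair => //.
    by apply: measurableT_comp.
  by apply: measurable_cons => //; apply: measurableT_comp.
apply: (@measurable_fun_fubini_tonelli_F _ _ _ _ _ (@lebesgue_measure R) G mG).
by move=> z; apply: lebesgue_iterated_ge0 => t; exact: F0.
Qed.

Lemma measurable_lebesgue_iterated_cons n (f : n.+1.-tuple R -> \bar R) :
  measurable_fun setT f -> (forall t, 0 <= f t) ->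
  measurable_fun [set: R] (fun x : R => LI (fun t : n.-tuple R => f [tuple of x :: t])).
Proof.
move=> mf f0.
apply: (@measurable_lebesgue_iterated n _ R (fun x t => f [tuple of x :: t])) => //.
have -> : (fun z : R * n.-tuple R => f [tuple of z.1 :: z.2]) =
     f \o (fun z : R * n.-tuple R => [tuple of z.1 :: z.2]) by [].
apply: measurableT_comp => //.
exact: measurable_cons.
Qed.

Lemma measurable_tuple_slice n (f : n.+1.-tuple R -> \bar R) (x : R) :
  measurable_fun setT f -> measurable_fun setT (fun t : n.-tuple R => f [tuple of x :: t]).
Proof.
move=> mf.
have -> : (fun t : n.-tuple R => f [tuple of x :: t]) =
    f \o (fun t : n.-tuple R => [tuple of x :: t]) by [].
apply: measurableT_comp => //.
by apply: measurable_cons => //; exact: measurable_cst.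
Qed.

Lemma lebesgue_iteratedD n (f g : n.-tuple R -> \bar R) :
  measurable_fun setT f -> measurable_fun setT g ->
  (forall t, 0 <= f t) -> (forall t, 0 <= g t) ->
  LI (fun t => f t + g t) = LI f + LI g.
Proof.
elim: n f g => [//|n IH] f g mf mg f0 g0 /=.
rewrite -ge0_integralD//; last 4 first.
- by move=> x _; exact: lebesgue_iterated_ge0.
- exact: measurable_lebesgue_iterated_cons.
- by move=> x _; exact: lebesgue_iterated_ge0.
- exact: measurable_lebesgue_iterated_cons.
apply: eq_integral => x _; rewrite IH//; exact: measurable_tuple_slice.
Qed.

Lemma lebesgue_iteratedZ n (k : \bar R) (f : n.-tuple R -> \bar R) :
  0 <= k -> measurable_fun setT f -> (forall t, 0 <= f t) ->
  LI (fun t => k * f t) = k * LI f.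
Proof.
elim: n f => [//|n IH] f k0 mf f0 /=.
rewrite -ge0_integralZl//; last 2 first.
- exact: measurable_lebesgue_iterated_cons.
- by move=> x _; exact: lebesgue_iterated_ge0.
apply: eq_integral => x _; rewrite IH//; exact: measurable_tuple_slice.
Qed.

Lemma lebesgue_iterated_sum n (I : eqType) (s : seq I) (f : I -> n.-tuple R -> \bar R) :
  (forall i, measurable_fun setT (f i)) -> (forall i t, 0 <= f i t) ->
  LI (fun t => \sum_(i <- s) f i t) = \sum_(i <- s) LI (f i).
Proof.
move=> mf f0; elim: s => [|i s IH].
  under eq_lebesgue_iterated do rewrite big_nil.
  by rewrite big_nil lebesgue_iterated0.
rewrite big_cons -IH -lebesgue_iteratedD//; last 2 first.
- exact: emeasurable_sum.
- by move=> t; exact: sume_ge0.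
by apply: eq_lebesgue_iterated => t; rewrite big_cons.
Qed.

Lemma le_lebesgue_iterated n (f g : n.-tuple R -> \bar R) :
  measurable_fun setT f -> measurable_fun setT g ->
  (forall t, 0 <= f t) -> (forall t, f t <= g t) -> LI f <= LI g.
Proof.
elim: n f g => [|n IH] f g mf mg f0 fg /=; first exact: fg.
have g0 t : 0 <= g t by exact: le_trans (fg t).
apply: ge0_le_integral => //.
- by move=> x _; exact: lebesgue_iterated_ge0.
- exact: measurable_lebesgue_iterated_cons.
- exact: measurable_lebesgue_iterated_cons.
- by move=> x _; apply: IH => //; exact: measurable_tuple_slice.
Qed.

(** Monotone convergence holds at each of the [n] nested integrals. *)
Lemma cvg_lebesgue_iterated n (g : nat -> n.-tuple R -> \bar R) (f : n.-tuple R -> \bar R) :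
  (forall k, measurable_fun setT (g k)) -> measurable_fun setT f ->
  (forall k t, 0 <= g k t) ->
  (forall t, nondecreasing_seq (g ^~ t)) ->
  (forall t, g ^~ t @ \oo --> f t) ->
  LI (g k) @[k --> \oo] --> LI f.
Proof.
elim: n g f => [|n IH] g f mg mf g0 ndg gf /=; first exact: gf.
have f0 t : 0 <= f t.
  rewrite -(cvg_lim _ (gf t))//; apply: lime_ge; first by apply/cvg_ex; exists (f t).
  by apply: nearW => k; exact: g0.
have H x : LI (fun t : n.-tuple R => g k [tuple of x :: t]) @[k --> \oo] -->
  LI (fun t : n.-tuple R => f [tuple of x :: t]).
  apply: (IH (fun k t => g k [tuple of x :: t])) => [k||k t|t|t].
  - exact: measurable_tuple_slice.
  - exact: measurable_tuple_slice.
  - exact: g0.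
  - exact: ndg.
  - exact: gf.
rewrite [X in _ --> X](_ : _ = \int[lebesgue_measure]_x
    limn (fun k => LI (fun t : n.-tuple R => g k [tuple of x :: t]))); last first.
  by apply: eq_integral => x _; apply/esym/cvg_lim => //; exact: H.
apply: cvg_monotone_convergence => //.
- by move=> k; exact: measurable_lebesgue_iterated_cons.
- by move=> k x _; exact: lebesgue_iterated_ge0.
- move=> x _ k l kl; apply: le_lebesgue_iterated => //; try exact: measurable_tuple_slice.
  by move=> t; exact: ndg.
Qed.

End IteratedIntegral.

(** * Expectations under a Dirichlet law *)

Import HBNNSimple.
Section DirichletExpectation.
Context {R : realType}.
Local Notation LI := (@lebesgue_iterated R _).

Lemma measurable_simplex_chart n :
  measurable_fun setT (@simplex_chart R n : n.-tuple R -> n.+1.-tuple R).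
Proof.
apply/measurable_fun_tnthP => i.
have [lt_in|] := ltnP i n.
  apply: (eq_measurable_fun (fun x : n.-tuple R => tnth x (Ordinal lt_in))).
    by move=> x _ /=; rewrite !(tnth_nth 0)/= nth_rcons size_tuple lt_in.
  exact: measurable_tnth.
move=> le_ni; apply: (eq_measurable_fun (fun x : n.-tuple R => 1 - \sum_(i < n) tnth x i)).
  move=> x _ /=; rewrite !(tnth_nth 0)/= nth_rcons size_tuple ltnNge le_ni/=.
  by rewrite eqn_leq le_ni -ltnS ltn_ord.
apply: measurable_funB; first exact: measurable_cst.
by apply: measurable_sum => j; exact: measurable_tnth.
Qed.

Lemma measurable_dirichlet_weight n (nu : 'I_n -> R) :
  measurable_fun setT (dirichlet_weight nu).
Proof.
apply: measurable_prod => i _.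
by apply: (measurableT_comp (measurable_powR _)); exact: measurable_tnth.
Qed.

Lemma measurable_simplex n : measurable (@simplex R n).
Proof.
have -> : @simplex R n =
    (\big[setI/setT]_(i < n) ((fun x : n.-tuple R => tnth x i) @^-1` `[0, 1]%classic))
    `&` (fun x : n.-tuple R => \sum_(i < n) tnth x i) @^-1` [set 1].
  apply/seteqP; split => x /=; rewrite -bigcap_seq; last first.
    move=> [x01 x1]; split => // i; have /= := x01 i; rewrite in_itv/=; apply.
    by rewrite mem_index_enum.
  by move=> [x01 x1]; split => // i _ /=; rewrite in_itv/=; exact: x01.
apply: measurableI.
  apply: bigsetI_measurable => i _; rewrite -[X in measurable X]setTI.
  exact: measurable_tnth.
rewrite -[X in measurable X]setTI.
have : measurable_fun setT (fun x : n.-tuple R => \sum_(i < n) tnth x i).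
  by apply: measurable_sum => j; exact: measurable_tnth.
by apply.
Qed.

(** The density of [mu] in the chart turns set-wise identities into an
expectation formula by approximation with simple functions. *)
Lemma dirichlet_expectation n (nu : 'I_n.+1 -> R)
    (mu : {measure set (n.+1.-tuple R) -> \bar R}) :
  dirichlet_law nu mu -> exists2 C : R, 0 < C &
  forall phi : n.+1.-tuple R -> R, measurable_fun setT phi -> (forall x, 0 <= phi x) ->
  (\int[mu]_x (phi x)%:E = C%:E * LI (fun x : n.-tuple R =>
    (\1_(@simplex R n.+1) (simplex_chart x) * dirichlet_weight nu (simplex_chart x)
      * phi (simplex_chart x))%:E))%E.
Proof.
move=> [nu0 [C C0 HC]]; exists C => // phi mphi phi0.
have mphiE : measurable_fun setT (EFin \o phi) by exact/measurable_EFinP.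
pose w (x : n.-tuple R) : R :=
  \1_(@simplex R n.+1) (simplex_chart x) * dirichlet_weight nu (simplex_chart x).
have w0 x : 0 <= w x.
  by rewrite mulr_ge0// prodr_ge0// => i _; exact: powR_ge0.
have mw : measurable_fun setT w.
  apply: measurable_funM; apply: (measurableT_comp _ (@measurable_simplex_chart n)).
  - by apply: measurable_indic; exact: measurable_simplex.
  - exact: measurable_dirichlet_weight.
pose g := nnsfun_approx measurableT mphiE.
have cvgg x : (EFin \o (fun k => g k x)) @ \oo --> (phi x)%:E.
  by apply: (@cvg_nnsfun_approx _ _ _ setT measurableT _ mphiE) => // y _; rewrite lee_fin.
have mchart (f : n.+1.-tuple R -> R) : measurable_fun setT f ->
    measurable_fun setT (fun x : n.-tuple R => (w x * f (simplex_chart x))%:E).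
  move=> mf; apply/measurable_EFinP; apply: measurable_funM => //.
  exact: (measurableT_comp mf (@measurable_simplex_chart n)).
have simple k : (\int[mu]_x (g k x)%:E =
    C%:E * LI (fun x : n.-tuple R => (w x * g k (simplex_chart x))%:E))%E.
  rewrite integralT_nnsfun sintegralE fsbig_finite//=.
  pose h y (x : n.-tuple R) : \bar R := (w x * (y * \1_(g k @^-1` [set y]) (simplex_chart x)))%:E.
  have mh y : measurable_fun setT (h y).
    apply: (mchart (fun x => y * \1_(g k @^-1` [set y]) x)).
    by apply: measurable_funM => //; exact: measurable_indic.
  have h0 y x : (0 <= h y x)%E.
    by rewrite lee_fin mulr_ge0// -lee_fin EFinM nnfun_muleindic_ge0.
  rewrite (_ : LI _ = LI (fun x => \sum_(y <- finmap.enum_fset (fset_set (range (g k)))) h y x)%E).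
    rewrite lebesgue_iterated_sum// ge0_sume_distrr; last first.
      by move=> y _; exact: lebesgue_iterated_ge0.
    apply: eq_big_seq => y.
    rewrite in_fset_set// inE => -[z _ zy].
    have y0 : 0 <= y by rewrite -zy.
    rewrite HC// muleA (muleC y%:E) -muleA; congr (_ * _)%E.
    rewrite -lebesgue_iteratedZ ?lee_fin//; last 2 first.
    - apply/measurable_EFinP; apply: measurable_funM;
        apply: (measurableT_comp _ (@measurable_simplex_chart n)).
      + apply: measurable_indic; apply: measurableI => //; exact: measurable_simplex.
      + exact: measurable_dirichlet_weight.
    - by move=> x; rewrite lee_fin mulr_ge0// prodr_ge0// => i _; exact: powR_ge0.
    apply: eq_lebesgue_iterated => x; rewrite /h /w -EFinM; congr EFin.
    by rewrite indicI/=; ring.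
  apply: eq_lebesgue_iterated => x; rewrite /h sumEFin; congr EFin.
  by rewrite -mulr_sumr; congr (_ * _); rewrite fimfunE fsbig_finite.
have L : (\int[mu]_x (g k x)%:E)%E @[k --> \oo] --> (\int[mu]_x (phi x)%:E)%E.
  rewrite (_ : \int[mu]_x (phi x)%:E =
      \int[mu]_x limn (fun k => (g k x)%:E))%E; last first.
    by apply: eq_integral => x _; apply/esym/cvg_lim => //; exact: cvgg.
  apply: cvg_monotone_convergence => //.
  - by move=> k; exact/measurable_EFinP.
  - by move=> k x _; rewrite lee_fin.
  - by move=> x _ k l kl; rewrite lee_fin; exact/lefP/nd_nnsfun_approx.
apply: (cvg_unique _ L) => //.
rewrite /mkset (funext simple).
apply: cvgeZl => //.
apply: cvg_lebesgue_iterated.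
- by move=> k; exact: mchart.
- exact: mchart.
- by move=> k x; rewrite lee_fin mulr_ge0.
- move=> x k l kl; rewrite lee_fin ler_wpM2l//; exact/lefP/nd_nnsfun_approx.
- move=> x; rewrite [X in X @ _ --> _](funext (fun k => EFinM (w x) (g k (simplex_chart x)))).
  rewrite EFinM.
  exact: (@cvgeZl _ _ R (fun k => (g k (simplex_chart x))%:E) _ (w x)%:E isT (cvgg _)).
Qed.

End DirichletExpectation.

(** * Beta integrals *)

Section Beta.
Context {R : realType}.
Local Notation mu := (@lebesgue_measure R).

Definition beta_integral (p q : R) : \bar R :=
  (\int[mu]_(x in `]0%R, 1%R[) (x `^ (p - 1) * (1 - x) `^ (q - 1))%:E)%E.

Lemma beta_integral_ge0 p q : (0 <= beta_integral p q)%E.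
Proof. by apply: integral_ge0 => x _; rewrite lee_fin mulr_ge0// powR_ge0. Qed.

Lemma measurable_powR_sub (r q : R) : measurable_fun setT (fun x : R => (r - x) `^ q).
Proof.
apply: (measurableT_comp (measurable_powR q)).
by apply: measurable_funB => //; exact: measurable_cst.
Qed.

Lemma measurable_beta_density (r p q : R) :
  measurable_fun setT (fun x : R => x `^ p * (r - x) `^ q).
Proof.
apply: measurable_funM; first exact: measurable_powR.
exact: measurable_powR_sub.
Qed.

(** From [x + (1 - x) = 1] under the integral. *)
Lemma beta_integral_split p q : 0 < p -> 0 < q ->
  (beta_integral (p + 1) q + beta_integral p (q + 1) = beta_integral p q)%E.
Proof.
move=> p0 q0; rewrite /beta_integral -ge0_integralD//; first last.
- apply/measurable_EFinP/measurable_funTS; exact: measurable_beta_density.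
- by move=> x _; rewrite lee_fin mulr_ge0// powR_ge0.
- apply/measurable_EFinP/measurable_funTS; exact: measurable_beta_density.
- by move=> x _; rewrite lee_fin mulr_ge0// powR_ge0.
apply: eq_integral => x; rewrite inE/= in_itv/= => /andP[x0 x1].
rewrite -EFinD !addrK -(mulr_powRB1 (ltW x0) p0).
rewrite -(@mulr_powRB1 _ (1 - x) q) ?subr_ge0 ?ltW//.
by congr EFin; ring.
Qed.

Lemma derivable_segment (F : R -> R) a b : a < b ->
  {in `[a, b], forall x, derivable F x 1} -> derivable_oo_LRcontinuous F a b.
Proof.
move=> ab dF; have := derivable_within_continuous dF.
move=> /(continuous_within_itvP _ ab)[_ Fa Fb]; split => // x xab.
by apply: dF; move: xab; rewrite !in_itv/= => /andP[/ltW -> /ltW ->].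
Qed.

Lemma is_derive_powR_sub (q x : R) : x < 1 ->
  is_derive x 1 (fun y : R => (1 - y) `^ q) (- (q * (1 - x) `^ (q - 1))).
Proof.
move=> x1; rewrite -[- (q * _)]mulrN1.
apply: (@is_derive1_comp _ ((@powR R)^~ q) (fun y => 1 - y)).
  by apply: is_derive1_powR; rewrite subr_gt0.
by rewrite -[X in is_derive _ _ _ X]add0r; apply: is_deriveB.
Qed.

(** Integration by parts away from the endpoints, where the integrands of
[beta_integral_parts] may be unbounded. *)
Lemma beta_parts_segment (p q a b : R) : 0 < q -> 0 < a -> b < 1 -> a < b ->
  (\int[mu]_(x in `[a, b]) (p * (x `^ (p - 1) * (1 - x) `^ q))%:E =
  (b `^ p * (1 - b) `^ q - a `^ p * (1 - a) `^ q)%:E +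
  \int[mu]_(x in `[a, b]) (q * (x `^ p * (1 - x) `^ (q - 1)))%:E)%E.
Proof.
move=> q0 a0 b1 ab.
have gt0 x : x \in `[a, b] -> 0 < x.
  by rewrite in_itv/= => /andP[+ _]; exact: lt_le_trans.
have lt1 x : x \in `[a, b] -> x < 1.
  by rewrite in_itv/= => /andP[_ xb]; exact: le_lt_trans b1.
have oo x : x \in `]a, b[ -> x \in `[a, b].
  by rewrite !in_itv/= => /andP[/ltW -> /ltW ->].
have dl (s : R) x : x \in `[a, b] -> derivable (fun x : R => x `^ s) x 1.
  by move=> /gt0 x0; have [] := is_derive1_powR s x0.
have dr (s : R) x : x \in `[a, b] -> derivable (fun x : R => (1 - x) `^ s) x 1.
  by move=> /lt1 x1; have [] := is_derive_powR_sub s x1.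
have cf : {within `[a, b], continuous (fun x : R => p * x `^ (p - 1))}.
  apply: derivable_within_continuous => x xab.
  by apply: derivableM => //; exact: dl.
have cg : {within `[a, b], continuous (fun x : R => - (q * (1 - x) `^ (q - 1)))}.
  apply: derivable_within_continuous => x xab.
  by apply: derivableN; apply: derivableM => //; exact: dr.
have dF : {in `]a, b[, (fun x : R => x `^ p)^`()%classic =1 (fun x => p * x `^ (p - 1))}.
  move=> x /oo/gt0 x0; rewrite derive1E.
  by have H := is_derive1_powR p x0; rewrite derive_val.
have dG : {in `]a, b[, (fun x : R => (1 - x) `^ q)^`()%classic =1
    (fun x => - (q * (1 - x) `^ (q - 1)))}.
  move=> x /oo/lt1 x1; rewrite derive1E.
  by have H := is_derive_powR_sub q x1; rewrite derive_val.
have := integration_by_parts ab cf (derivable_segment ab (dl p)) dF cg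
  (derivable_segment ab (dr q)) dG.
have FgE x : (x `^ p * - (q * (1 - x) `^ (q - 1)))%:E =
    (- (q * (x `^ p * (1 - x) `^ (q - 1)))%:E)%E.
  by rewrite -EFinN; congr EFin; ring.
under eq_integral do rewrite FgE.
rewrite integral_ge0N; last first.
  by move=> x _; rewrite lee_fin !mulr_ge0// ?powR_ge0// ltW.
under [X in (_ = _ - X)%E -> _]eq_integral do rewrite -mulrA.
move: (b `^ p * _ - _) => c.
move: (\int[mu]_(x in _) (q * _)%:E)%E => B.
move: (\int[mu]_(x in _) (p * _)%:E)%E => A.
by case: A B => [A||] [B||] //= [BA]; rewrite -EFinD; congr EFin; lra.
Qed.

(** The boundary terms of the integration by parts vanish as the segment grows
to the unit interval, while both integrals increase to their limits. *)
Lemma beta_integral_parts p q : 0 < p -> 0 < q ->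
  (p%:E * beta_integral p (q + 1) = q%:E * beta_integral (p + 1) q)%E.
Proof.
move=> p0 q0.
(* The shift by 3 keeps [a n] below one half. *)
pose a (n : nat) : R := n.+3%:R^-1.
have a_gt0 n : 0 < a n by rewrite invr_gt0.
have a_lt n : a n < 1 - a n.
  rewrite -subr_gt0 (_ : _ - _ = (n.+1%:R) / n.+3%:R) ?divr_gt0//.
  rewrite /a -(@natr1 _ n.+2) -(@natr1 _ n.+1).
  have : n.+1%:R + 1 + 1 != 0 :> R by rewrite !natr1.
  by move=> n0; field.
have b_lt n : 1 - a n < 1 by rewrite ltrBlDr ltrDl.
pose D n : set R := `[a n, 1 - a n]%classic.
have a_noninc m n : (m <= n)%N -> a n <= a m.
  by move=> mn; rewrite lef_pV2 ?posrE// ler_nat !ltnS.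
have D_homo : {homo D : n m / (n <= m)%N >-> (n <= m)%O}.
  move=> m n mn; apply/subsetPset => x; rewrite /D/= !in_itv/= => /andP[ax xb].
  by rewrite (le_trans (a_noninc _ _ mn) ax)/= (le_trans xb)// lerB// a_noninc.
have a_cvg0 : a @ \oo --> 0.
  have -> : a = [sequence (harmonic (n + 2)%N : R)]_n by apply/funext => n; rewrite /a/= addn2.
  by rewrite cvg_shiftn; exact: cvg_harmonic.
have UD : \bigcup_n D n = `]0, 1[%classic.
  apply/seteqP; split => [x [n _]|x]; rewrite /D/= !in_itv/= => /andP[x0 x1].
    by rewrite (lt_le_trans (a_gt0 n) x0) (le_lt_trans x1 (b_lt n)).
  pose e := Num.min x (1 - x).
  have e0 : 0 < e by rewrite lt_min x0 subr_gt0.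
  have [N _ HN] := cvgr_lt _ a_cvg0 _ e0.
  exists N => //=; have /ltW := HN N (leqnn N); rewrite le_min => /andP[ax ax1].
  by rewrite in_itv/= ax; move: ax1; lra.
have cvgD (c s t : R) : 0 <= c ->
    (\int[mu]_(x in D n) (c * (x `^ s * (1 - x) `^ t))%:E)%E @[n --> \oo] -->
    (c%:E * \int[mu]_(x in `]0%R, 1%R[) (x `^ s * (1 - x) `^ t)%:E)%E.
  move=> c0; rewrite -ge0_integralZl//; last 2 first.
  - apply/measurable_EFinP/measurable_funTS; exact: measurable_beta_density.
  - by move=> x _; rewrite lee_fin mulr_ge0// powR_ge0.
  rewrite -UD; apply: ge0_nondecreasing_set_cvg_integral => //.
  - by move=> n; exact: measurable_itv.
  - move=> n; apply/measurable_EFinP/measurable_funTS/measurable_funM => //.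
    exact: measurable_beta_density.
  - by move=> n x _; rewrite lee_fin !mulr_ge0// powR_ge0.
rewrite /beta_integral !addrK.
apply: (cvg_unique _ (cvgD p (p - 1) q (ltW p0))) => //.
rewrite /mkset -[X in _ --> X]add0e.
rewrite (_ : (fun n => _) = (fun n =>
  ((1 - a n) `^ p * (1 - (1 - a n)) `^ q - a n `^ p * (1 - a n) `^ q)%:E +
  \int[mu]_(x in D n) (q * (x `^ p * (1 - x) `^ (q - 1)))%:E)%E); last first.
  by apply/funext => n; exact: beta_parts_segment.
apply: cvgeD => //; last by apply: cvgD; exact: ltW.
apply/cvg_EFin; first exact: nearW.
rewrite /comp/=.
have a_pow (s : R) : 0 < s -> a n `^ s @[n --> \oo] --> 0.
  by move=> s0; move/cvg_at_rightP: (powR_cvg0 s0); apply.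
have le1 (s : R) n : 0 < s -> (1 - a n) `^ s <= 1.
  move=> s0; rewrite -[leRHS](congr1 (@^~ s) (powR1 R)) ge0_ler_powR// ?nnegrE ?ltW//.
  exact: lt_trans (a_lt n).
rewrite -[X in _ --> X](subr0 0); apply: cvgB.
  apply: (@squeeze_cvgr _ _ _ _ (cst 0) (fun n => a n `^ q)) (a_pow q q0); last exact: cvg_cst.
  apply: nearW => n /=; rewrite mulr_ge0 ?powR_ge0//= subKr.
  by rewrite ler_piMl ?powR_ge0// le1.
apply: (@squeeze_cvgr _ _ _ _ (cst 0) (fun n => a n `^ p)) (a_pow p p0); last exact: cvg_cst.
apply: nearW => n /=; rewrite mulr_ge0 ?powR_ge0//=.
by rewrite ler_piMr ?powR_ge0// le1.
Qed.

(** The two relations above form a linear system for the Beta integrals with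
one exponent raised. It is solved in the extended reals, where it makes sense
before the integrals are known to converge. *)
Lemma beta_integral_succ p q : 0 < p -> 0 < q ->
  ((p + q)%:E * beta_integral (p + 1) q = p%:E * beta_integral p q)%E.
Proof.
move=> p0 q0; rewrite -(beta_integral_split p0 q0).
rewrite EFinD ge0_muleDl ?lee_fin ?ltW// -(beta_integral_parts p0 q0).
by rewrite -ge0_muleDr ?beta_integral_ge0.
Qed.

Lemma beta_integral_succr p q : 0 < p -> 0 < q ->
  ((p + q)%:E * beta_integral p (q + 1) = q%:E * beta_integral p q)%E.
Proof.
move=> p0 q0; rewrite -(beta_integral_split p0 q0).
rewrite EFinD ge0_muleDl ?lee_fin ?ltW// (beta_integral_parts p0 q0).
by rewrite -ge0_muleDr ?beta_integral_ge0.
Qed.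

(** The image of the Lebesgue measure under a dilation is a multiple of it,
as one sees on intervals. *)
Lemma ge0_integral_scale (r : R) (f : R -> \bar R) : 0 < r ->
  measurable_fun setT f -> (forall x, 0 <= f x)%E ->
  (\int[mu]_x f x = r%:E * \int[mu]_x f (r * x)%R)%E.
Proof.
move=> r0 mf f0.
have mr : measurable_fun setT ( *%R r : R -> R) by exact: mulrl_measurable.
pose m := mscale (NngNum (ltW r0)) (pushforward mu ( *%R r : _ -> measurableTypeR R))
  : {measure set _ -> \bar R}.
have mE A : measurable A -> mu A = m mr A.
  apply: lebesgue_measure_unique => _ [[a b]] _ <-.
  rewrite (_ : m mr _ = (r%:E * mu `](a / r)%R, (b / r)%R]%classic)%E); last first.
    congr (_ * mu _)%E.
    by apply/seteqP; split => x /=; rewrite !in_itv/= ltr_pdivrMr// ler_pdivlMr// mulrC.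
  rewrite !lebesgue_measure_itv/= !lte_fin ltr_pM2r ?invr_gt0//.
  case: ifP => _; last by rewrite mule0.
  by rewrite -EFinM -mulrBl mulrC divfK// gt_eqF.
rewrite (eq_measure_integral (m mr)); last by move=> A mA _; exact: mE.
rewrite ge0_integral_mscale// ge0_integral_pushforward//.
Qed.

(** The convolution of two powers is again a power: this is what keeps the
nested integrals of a Dirichlet density in closed form. *)
Lemma beta_integral_scale (p q r : R) : 0 < r ->
  (\int[mu]_(x in `]0%R, r[) (x `^ (p - 1) * (r - x) `^ (q - 1))%:E =
   beta_integral p q * (r `^ (p + q - 1))%:E)%E.
Proof.
move=> r0.
pose g (s x : R) := (x `^ (p - 1) * (s - x) `^ (q - 1))%:E.
have g0 s x : (0 <= g s x)%E by rewrite lee_fin mulr_ge0// powR_ge0.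
have mg s (t : R) : measurable_fun `]0, t[ (g s).
  by apply/measurable_EFinP/measurable_funTS; exact: measurable_beta_density.
rewrite integral_mkcond (ge0_integral_scale r0); last 2 first.
- by apply/(measurable_restrictT _ _).1 => //; exact: mg.
- by move=> x; rewrite patchE; case: ifP => // _; exact: (g0 r).
rewrite [X in (_ = _ * X)%E](_ : _ = r%:E * (r `^ (p + q - 2))%:E)%E; last first.
  transitivity (r `^ 1 * r `^ (p + q - 2))%:E; last by rewrite powRr1 ?ltW.
  rewrite -powRD; last by apply/implyP => _; rewrite gt_eqF.
  by congr (_ `^ _)%:E; ring.
rewrite /beta_integral [in RHS]integral_mkcond muleCA; congr (_ * _)%E.
rewrite [RHS]muleC -ge0_integralZl//; last 3 first.
- by apply/(measurable_restrictT _ _).1 => //; exact: (mg 1).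
- by move=> x _; rewrite patchE; case: ifP => // _; exact: (g0 1).
- by rewrite lee_fin powR_ge0.
apply: eq_integral => x _; rewrite !patchE.
rewrite (_ : (r * x \in `]0, r[%classic) = (x \in `]0, 1[%classic)); last first.
  by apply/idP/idP; rewrite !inE/= !in_itv/= pmulr_rgt0// gtr_pMr.
case: ifPn => [|_]; last by rewrite mule0.
rewrite inE/= in_itv/= => /andP[x0 x1].
have -> : r - r * x = r * (1 - x) by ring.
rewrite !powRM ?subr_ge0 ?ltW// -EFinM; congr EFin.
have -> : p + q - 2 = (p - 1) + (q - 1) by ring.
rewrite [in RHS]powRD; first by ring.
by apply/implyP => _; rewrite gt_eqF.
Qed.
End Beta.

(** * Moments of the Dirichlet law *)

Section DirichletMoments.
Context {R : realType}.
Local Notation LI := (@lebesgue_iterated R _).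
Local Notation mu := (@lebesgue_measure R).

(** A power that vanishes on negative numbers, so that a product of such powers
carries the constraint of nonnegative coordinates. *)
Definition powR_nneg (s x : R) : R := \1_(`[0, +oo[%classic) x * x `^ s.

Lemma powR_nneg_ge0 s x : 0 <= powR_nneg s x.
Proof. by rewrite mulr_ge0// powR_ge0. Qed.

Lemma powR_nneg_pos s x : 0 <= x -> powR_nneg s x = x `^ s.
Proof. by move=> x0; rewrite /powR_nneg indicE mem_set ?mul1r//= in_itv/= x0. Qed.

Lemma powR_nneg_neg s x : x < 0 -> powR_nneg s x = 0.
Proof.
move=> x0; rewrite /powR_nneg indicE memNset ?mul0r//=.
by rewrite in_itv/= andbT leNgt x0.
Qed.

Lemma measurable_powR_nneg s : measurable_fun setT (powR_nneg s).
Proof.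
apply: measurable_funM; last exact: measurable_powR.
by apply: measurable_indic; exact: measurable_itv.
Qed.

(** The unnormalised Dirichlet density on the simplex of sum [r]: the last
coordinate is what the entries of [s] leave of [r]. *)
Fixpoint dirichlet_density (p : nat -> R) (r : R) (s : seq R) : R :=
  if s is x :: s' then
    powR_nneg (p 0%N - 1) x * dirichlet_density (fun i => p i.+1) (r - x) s'
  else powR_nneg (p 0%N - 1) r.

Lemma dirichlet_density_ge0 p r s : 0 <= dirichlet_density p r s.
Proof.
elim: s p r => [|x s IH] p r /=; first exact: powR_nneg_ge0.
by rewrite mulr_ge0// powR_nneg_ge0.
Qed.

Lemma dirichlet_density_prod p r s : dirichlet_density p r s =
  \prod_(i < (size s).+1) powR_nneg (p i - 1) (nth 0 (rcons s (r - \sum_(x <- s) x)) i).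
Proof.
elim: s p r => [|x s IH] p r /=; first by rewrite big_ord1 big_nil subr0.
rewrite big_ord_recl/= IH; congr (_ * _); apply: eq_bigr => i _.
by rewrite big_cons opprD addrA.
Qed.

Lemma measurable_dirichlet_density_pair n p :
  measurable_fun setT (fun z : R * n.-tuple R => dirichlet_density p z.1 z.2).
Proof.
elim: n p => [|n IH] p.
  rewrite [X in measurable_fun _ X](_ : _ = powR_nneg (p 0%N - 1) \o fst).
    by apply: measurableT_comp => //; exact: measurable_powR_nneg.
  by apply/funext => -[r t]/=; rewrite tuple0.
rewrite [X in measurable_fun _ X](_ : _ = fun z : R * n.+1.-tuple R =>
  powR_nneg (p 0%N - 1) (tnth z.2 ord0) *
  dirichlet_density (fun i => p i.+1) (z.1 - tnth z.2 ord0) [tuple of behead z.2]); last first.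
  by apply/funext => -[r t]; case/tupleP: t => x t; rewrite !(tnth_nth 0).
have mt : measurable_fun setT (fun z : R * n.+1.-tuple R => tnth z.2 ord0).
  by apply: (measurableT_comp (measurable_tnth _)).
apply: measurable_funM.
  by apply: (measurableT_comp (measurable_powR_nneg _)).
pose h (z : R * n.+1.-tuple R) : R * n.-tuple R :=
  (z.1 - tnth z.2 ord0, [tuple of behead z.2]).
apply: (measurableT_comp (IH (fun i => p i.+1)) (_ : measurable_fun setT h)).
apply: measurable_fun_pair; first exact: measurable_funB.
by apply: (measurableT_comp (@measurable_behead _ R n)) => //; exact: measurable_snd.
Qed.

Lemma measurable_dirichlet_density n p r :
  measurable_fun setT (fun t : n.-tuple R => (dirichlet_density p r t)%:E).
Proof.
apply/measurable_EFinP.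
exact: (measurable_fun_pair2 r (measurable_dirichlet_density_pair p)).
Qed.

(** The total mass of the density on the simplex of sum one: one Beta integral
for each coordinate that is integrated out. *)
Fixpoint dirichlet_const (n : nat) (p : nat -> R) : \bar R :=
  if n is n'.+1 then
    (beta_integral (p 0%N) (\sum_(i < n'.+1) p i.+1) *
     dirichlet_const n' (fun i => p i.+1))%E
  else 1%E.

Lemma dirichlet_const_ge0 n p : (0 <= dirichlet_const n p)%E.
Proof. by elim: n p => [//|n IH] p /=; rewrite mule_ge0// beta_integral_ge0. Qed.

Lemma eq_dirichlet_const n p p' : (forall i, (i <= n)%N -> p i = p' i) ->
  dirichlet_const n p = dirichlet_const n p'.
Proof.
elim: n p p' => [//|n IH] p p' pp' /=; rewrite pp'//; congr (beta_integral _ _ * _)%E.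
  by apply: eq_bigr => i _; rewrite pp'// ltn_ord.
by apply: IH => i le_in; rewrite pp'.
Qed.

Lemma lebesgue_iterated_dirichlet_lt0 n p r : r < 0 ->
  LI (fun t : n.-tuple R => (dirichlet_density p r t)%:E) = 0%E.
Proof.
elim: n p r => [|n IH] p r r0 /=; first by rewrite powR_nneg_neg.
apply: integral0_eq => x _.
under eq_lebesgue_iterated do rewrite EFinM.
rewrite lebesgue_iteratedZ ?lee_fin ?powR_nneg_ge0//; last 2 first.
- exact: measurable_dirichlet_density.
- by move=> t; rewrite lee_fin dirichlet_density_ge0.
have [x0|x0] := leP 0 x; last by rewrite powR_nneg_neg// mul0e.
by rewrite IH ?mule0// subr_lt0 (lt_le_trans r0).
Qed.

(** Once the first coordinate is fixed to [x], the other ones range over the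
simplex of sum [r - x]; integrating the resulting power of [r - x] against a
power of [x] is a Beta integral. *)
Lemma lebesgue_iterated_dirichlet n p r : (forall i, 0 < p i) -> 0 < r ->
  LI (fun t : n.-tuple R => (dirichlet_density p r t)%:E) =
  (dirichlet_const n p * (r `^ (\sum_(i < n.+1) p i - 1))%:E)%E.
Proof.
elim: n p r => [|n IH] p r p0 r0 /=.
  by rewrite powR_nneg_pos ?ltW// big_ord1 mul1e.
set q := \sum_(i < n.+1) p i.+1.
pose f x := LI (fun t : n.-tuple R => (dirichlet_density p r [tuple of x :: t])%:E).
have mf : measurable_fun setT f.
  apply: (@measurable_lebesgue_iterated_cons _ n (fun t => (dirichlet_density p r t)%:E)).
    exact: measurable_dirichlet_density.
  by move=> t; rewrite lee_fin dirichlet_density_ge0.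
have fE x : f x = ((powR_nneg (p 0%N - 1) x)%:E *
    LI (fun t : n.-tuple R => (dirichlet_density (fun i => p i.+1) (r - x) t)%:E))%E.
  rewrite -lebesgue_iteratedZ ?lee_fin ?powR_nneg_ge0//.
  - by apply: measurable_dirichlet_density.
  - by move=> t; rewrite lee_fin dirichlet_density_ge0.
transitivity (\int[mu]_(x in `[0%R, r]) f x)%E.
  rewrite [RHS]integral_mkcond; apply: eq_integral => x _.
  rewrite -/(f x) patchE; case: ifPn => //.
  rewrite notin_setE/= in_itv/= => /negP; rewrite negb_and -!ltNge => /orP[x0|xr].
    by rewrite fE powR_nneg_neg// mul0e.
  by rewrite fE lebesgue_iterated_dirichlet_lt0 ?mule0// subr_lt0.
rewrite integral_itv_bndoo; last exact: measurable_funTS.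
rewrite big_ord_recl/= -/q.
rewrite muleAC -beta_integral_scale// muleC.
rewrite -ge0_integralZl ?dirichlet_const_ge0//; last 2 first.
- by apply/measurable_EFinP/measurable_funTS; exact: measurable_beta_density.
- by move=> x _; rewrite lee_fin mulr_ge0// powR_ge0.
apply: eq_integral => x; rewrite inE/= in_itv/= => /andP[x0 xr].
rewrite fE IH ?subr_gt0// powR_nneg_pos ?ltW//.
by rewrite muleCA EFinM.
Qed.

(** Raising the [k]-th exponent by one either raises the first argument of the
outer Beta integral, or raises its second argument and leaves the rest to the
induction; both have a known ratio, and the factors telescope. *)
Lemma dirichlet_const_succ n (p : nat -> R) (k : 'I_n.+1) : (forall i, 0 < p i) ->
  ((\sum_(i < n.+1) p i)%:E *
     dirichlet_const n (fun i => p i + (i == k :> nat)%:R)%R =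
   (p k)%:E * dirichlet_const n p)%E.
Proof.
elim: n p k => [|n IH] p k p0 /=.
  by rewrite big_ord1; case: k => -[].
have q0 : 0 < \sum_(i < n.+1) p i.+1.
  by rewrite big_ord_recl ltr_pwDl//; apply: sumr_ge0 => i _; exact: ltW.
rewrite big_ord_recl/=; set q := (X in (_ + X)%:E).
case: (unliftP ord0 k) => [k'|] ->; rewrite /= ?eqxx ?addr0.
  rewrite (_ : \sum_(i < n.+1) _ = q + 1); last first.
    rewrite big_split/=; congr (_ + _); rewrite (bigD1 k')//= big1 ?addr0.
      by rewrite /bump/= add1n eqxx.
    by move=> i ik; rewrite /bump/= add1n eqSS (inj_eq val_inj) (negbTE ik).
  rewrite muleA beta_integral_succr//.
  rewrite [in LHS](_ : (fun i => _) = (fun i => p i.+1 + (i == k' :> nat)%:R)); last first.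
    by apply/funext => i; rewrite /bump/= add1n eqSS.
  rewrite muleAC (IH (fun i => p i.+1) k')// /bump/= add1n.
  by rewrite -muleA; congr (_ * _)%E; rewrite muleC.
rewrite (_ : \sum_(i < n.+1) _ = q); last by apply: eq_bigr => i _; rewrite addr0.
rewrite [in LHS](_ : (fun i => _) = (fun i => p i.+1)); last first.
  by apply/funext => i; rewrite addr0.
by rewrite muleA beta_integral_succ// muleA.
Qed.

(** The coordinates of a point of the chart always sum to one, so the point
leaves the simplex only through a negative coordinate, where [powR_nneg]
vanishes. *)
Lemma simplex_chart_density n (nu : 'I_n.+1 -> R) (j : 'I_n.+1 -> nat) (t : n.-tuple R) :
  (forall i, 0 < nu i) ->
  \1_(@simplex R n.+1) (simplex_chart t) * dirichlet_weight nu (simplex_chart t) *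
    \prod_(i < n.+1) `|tnth (simplex_chart t) i| ^+ j i =
  dirichlet_density (fun i => nu (inord i) + (j (inord i))%:R) 1 t.
Proof.
move=> nu0.
set y := simplex_chart t.
have -> : dirichlet_density (fun i => nu (inord i) + (j (inord i))%:R) 1 t =
    \prod_(i < n.+1) powR_nneg (nu i + (j i)%:R - 1) (tnth y i).
  rewrite dirichlet_density_prod size_tuple; apply: eq_bigr => i _.
  by rewrite inord_val (tnth_nth 0)/= big_tuple.
have y1 : \sum_(i < n.+1) tnth y i = 1.
  rewrite -(big_tuple _ _ y xpredT id)/= -cats1 big_cat/= big_seq1.
  by rewrite big_tuple addrC subrK.
have [y0|] := pselect (forall i, 0 <= tnth y i).
  rewrite indicE mem_set/=; last first.
    split => // i; rewrite y0/= -y1 (bigD1 i)//= lerDl sumr_ge0//.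
  rewrite mul1r -big_split/=; apply: eq_bigr => i _.
  rewrite powR_nneg_pos// ger0_norm//.
  case: (j i) => [|k]; first by rewrite expr0 mulr1 addr0.
  rewrite -powR_mulrn// -powRD; last first.
    apply/implyP; rewrite gt_eqF// -natr1.
    by have := ler0n R k; have := nu0 i; lra.
  by congr (_ `^ _); ring.
move=> /existsNP[i /negP]; rewrite -ltNge => yi.
rewrite indicE memNset ?mul0r.
  by rewrite (bigD1 i)//= powR_nneg_neg// mul0r.
by move=> [+ _] => /(_ i)/andP[]; rewrite leNgt yi.
Qed.

(** Multiplying the density by a coordinate raises one of its exponents by one,
so ratios of moments are ratios of normalising constants. The absolute values
make the monomials nonnegative off the simplex. *)
Lemma dirichlet_moment_succ n (nu : 'I_n.+1 -> R)
    (m : {measure set (n.+1.-tuple R) -> \bar R}) (j : 'I_n.+1 -> nat) (k : 'I_n.+1) :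
  dirichlet_law nu m ->
  ((\sum_i (nu i + (j i)%:R))%:E *
     \int[m]_x (\prod_i `|tnth x i| ^+ (j i + (i == k)))%:E =
   (nu k + (j k)%:R)%:E * \int[m]_x (\prod_i `|tnth x i| ^+ (j i))%:E)%E.
Proof.
move=> dir; have nu0 : forall i, 0 < nu i by case: dir.
have [C C0 HC] := dirichlet_expectation dir.
have mon (l : 'I_n.+1 -> nat) : (\int[m]_x (\prod_i `|tnth x i| ^+ (l i))%:E =
    C%:E * dirichlet_const n (fun i => nu (inord i) + (l (inord i))%:R)%R)%E.
  rewrite HC; last first.
  - by move=> x; rewrite prodr_ge0.
  - apply: measurable_prod => i _; apply: measurable_funX.
    by apply: (measurableT_comp (@normr_measurable R setT)); exact: measurable_tnth.
  under eq_lebesgue_iterated do rewrite simplex_chart_density//.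
  rewrite lebesgue_iterated_dirichlet//; last by move=> i; rewrite ltr_wpDr.
  by rewrite (congr1 (@^~ _) (powR1 R)) mule1.
rewrite !mon.
pose p i := nu (inord i) + (j (inord i))%:R.
rewrite (@eq_dirichlet_const n _ (fun i => p i + (i == k :> nat)%:R)); last first.
  by move=> i le_in; rewrite /p natrD addrA -[k in LHS]inord_val -val_eqE/= !inordK.
have p0 i : 0 < p i by rewrite ltr_wpDr.
have := @dirichlet_const_succ n p k p0.
rewrite /p inord_val; under eq_bigr do rewrite inord_val.
by move=> H; rewrite muleCA H muleCA.
Qed.
End DirichletMoments.

(** * Splitting an urn into independent sub-urns *)

Section UrnMean.
Context {R : realType}.
Variables a b c d : nat.
Local Notation step := (urn_step a b c d).

Fixpoint urn_mean (n : nat) (u : nat * nat) (g : nat * nat -> R) : R :=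
  if n is n'.+1 then
    u.1%:R / (u.1 + u.2)%:R * urn_mean n' (step u true) g +
    u.2%:R / (u.1 + u.2)%:R * urn_mean n' (step u false) g
  else g u.

Lemma urn_mean_linear n u (p q : R) g h :
  urn_mean n u (fun w => p * g w + q * h w) = p * urn_mean n u g + q * urn_mean n u h.
Proof. by elim: n u => [//|n IH] u /=; rewrite !IH; ring. Qed.

(** The convolution operator of the law of [s * u2] of an urn started at [u] and
drawn [n] times, acting on functions. *)
Definition urn_operator (s : R) (u : nat * nat) (n : nat) (phi : R -> R) (x : R) : R :=
  urn_mean n u (fun w => phi (x + s * u2 a b c R w)).

End UrnMean.

Section ProductOperators.
Context {R : realType} {I : eqType}.
Implicit Types (A : I -> (R -> R) -> R -> R) (f : R -> R).

Definition operator_product (r : seq I) A f : R -> R := foldr A f r.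

Definition linear_operator (B : (R -> R) -> R -> R) :=
  forall p q phi psi, B (fun x => p * phi x + q * psi x) =
    (fun x => p * B phi x + q * B psi x).

(** A product of linear operators is linear in each of its factors. *)
Lemma operator_product_slot (r : seq I) A A1 A2 (k : I) (p q : R) f :
  uniq r -> k \in r -> (forall i, linear_operator (A i)) ->
  (forall i, i != k -> A1 i = A i /\ A2 i = A i) ->
  (forall phi x, A k phi x = p * A1 k phi x + q * A2 k phi x) ->
  forall x, operator_product r A f x =
    p * operator_product r A1 f x + q * operator_product r A2 f x.
Proof.
move=> + + lin eqA Ak; elim: r => [//|i r IH] /= /andP[ir ur].
have notin_r B : (forall i, i != k -> B i = A i) -> k \notin r -> foldr B f r = foldr A f r.
  move=> eqB; elim: r {IH ir ur} => [//|l r IH] /=; rewrite inE negb_or => /andP[kl kr].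
  by rewrite IH// eqB// eq_sym.
rewrite inE eq_sym; have [ik|ik] /= := eqVneq i k.
  move=> _ x; subst i; rewrite /operator_product/= Ak !notin_r// => i /eqA[].
    by [].
  by [].
move=> kr x; rewrite /operator_product/= (eqA i ik).1 (eqA i ik).2.
by have -> := funext (IH ur kr : foldr A f r =1 _); rewrite lin.
Qed.
End ProductOperators.

Section MomentMean.
Context {R : realType} {N : nat}.
Implicit Types (j : 'I_N -> nat) (g : ('I_N -> nat) -> R).

Definition incr_at k j : 'I_N -> nat := fun i => (j i + (i == k))%N.

Fixpoint multinomial_mean (n : nat) (v : 'I_N -> R) g : R :=
  if n is n'.+1 then
    \sum_k v k * multinomial_mean n' v (fun j => g (incr_at k j))
  else g (fun=> 0%N).

(** Expectation of [V ^ j] times the multinomial mean of [g] with random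
weights [V], when [m] gives the moments of [V]. *)
Fixpoint moment_mean (m : ('I_N -> nat) -> R) (n : nat) j g : R :=
  if n is n'.+1 then \sum_k moment_mean m n' (incr_at k j) (fun i => g (incr_at k i))
  else m j * g (fun=> 0%N).

Lemma moment_mean_linear m n j (p q : R) g h :
  moment_mean m n j (fun i => p * g i + q * h i) =
  p * moment_mean m n j g + q * moment_mean m n j h.
Proof.
elim: n j g h => [|n IH] j g h /=; first by ring.
by under eq_bigr do rewrite IH; rewrite big_split/= !mulr_sumr.
Qed.
End MomentMean.

Section Forest.
Context {R : realType}.
Variables (a b c d S N : nat).
Hypotheses (abS : (a + b)%N = S) (cdS : (c + d)%N = S).
Local Notation step := (urn_step a b c d).
Implicit Types (j : 'I_N -> nat) (u : 'I_N -> nat * nat).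

(** The mean of [f] of [s * u2] of the union of independent urns, the [k]-th one
started at [u k] and drawn [j k] times: independence makes it a product of
convolution operators. *)
Definition forest_mean (s : R) (f : R -> R) u j : R :=
  operator_product (enum 'I_N) (fun k => urn_operator a b c d s (u k) (j k)) f 0.

Definition update u k w : 'I_N -> nat * nat := fun i => if i == k then w else u i.

Lemma urn_operator_linear (s : R) w n : linear_operator (urn_operator a b c d s w n).
Proof. by move=> p q phi psi; apply/funext => x; rewrite /urn_operator urn_mean_linear. Qed.

(** Conditioning on the colour of the first draw from the [k]-th urn. *)
Lemma forest_mean_step (s : R) f u k j :
  forest_mean s f u (incr_at k j) =
  (u k).1%:R / ((u k).1 + (u k).2)%:R * forest_mean s f (update u k (step (u k) true)) j +
  (u k).2%:R / ((u k).1 + (u k).2)%:R * forest_mean s f (update u k (step (u k) false)) j.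
Proof.
apply: (operator_product_slot (k := k)).
- exact: enum_uniq.
- by rewrite mem_enum.
- by move=> i; exact: urn_operator_linear.
- by move=> i ik; rewrite /update /incr_at (negbTE ik) addn0.
- by move=> phi x; rewrite /urn_operator /update /incr_at eqxx addn1.
Qed.

Lemma u2_sum u :
  u2 a b c R (\sum_k (u k).1, \sum_k (u k).2)%N = \sum_k u2 a b c R (u k).
Proof.
rewrite /u2/= !natr_sum !mulr_sumr -sumrB mulr_suml.
by apply: eq_bigr.
Qed.

Lemma forest_mean0 (s : R) f u :
  forest_mean s f u (fun=> 0%N) = f (s * u2 a b c R (\sum_k (u k).1, \sum_k (u k).2)%N).
Proof.
rewrite /forest_mean u2_sum -[in RHS]big_enum/=.
suff H r x : operator_product r (fun k => urn_operator a b c d s (u k) 0) f x =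
    f (x + s * \sum_(k <- r) u2 a b c R (u k)) by rewrite H add0r.
elim: r x => [|k r IH] x; first by rewrite big_nil mulr0 addr0.
by rewrite big_cons mulrDr addrA -IH.
Qed.

Lemma sum_update1 u k w :
  (\sum_i (update u k w i).1 = \sum_i (u i).1 + w.1 - (u k).1)%N.
Proof.
rewrite (bigD1 k)//= /update eqxx [in RHS](bigD1 k)//=.
rewrite (eq_bigr (fun i => (u i).1)); last by move=> i /negbTE ->.
by rewrite -addnA addKn addnC.
Qed.

Lemma sum_update2 u k w :
  (\sum_i (update u k w i).2 = \sum_i (u i).2 + w.2 - (u k).2)%N.
Proof.
rewrite (bigD1 k)//= /update eqxx [in RHS](bigD1 k)//=.
rewrite (eq_bigr (fun i => (u i).2)); last by move=> i /negbTE ->.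
by rewrite -addnA addKn addnC.
Qed.

Lemma step_sum u k red :
  step (\sum_i (u i).1, \sum_i (u i).2)%N red =
  (\sum_i (update u k (step (u k) red) i).1, \sum_i (update u k (step (u k) red) i).2)%N.
Proof.
rewrite sum_update1 sum_update2 /urn_step.
by case: red => /=; congr pair; rewrite addnCA addKn addnC.
Qed.

(** A draw from the pooled urn is a draw from the [k]-th urn with probability
proportional to its size, and sizes evolve as the moments of a Dirichlet
vector do under multiplication by its [k]-th coordinate. *)
Lemma urn_mean_forest (m : ('I_N -> nat) -> R) (s : R) f n u j :
  (forall j k, (N + S * \sum_i j i)%:R * m (incr_at k j) = (1 + S * j k)%:R * m j) ->
  (forall k, ((u k).1 + (u k).2)%N = (1 + S * j k)%N) ->
  m j * urn_mean a b c d n (\sum_i (u i).1, \sum_i (u i).2)%N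
     (fun w => f (s * u2 a b c R w)) =
  moment_mean m n j (forest_mean s f u).
Proof.
move=> mE; elim: n u j => [|n IH] u j uj; first by rewrite /= forest_mean0.
have tot : (\sum_i (u i).1 + \sum_i (u i).2 = N + S * \sum_i j i)%N.
  rewrite -big_split/= (eq_bigr _ (fun i _ => uj i)) big_split/= sum1_card card_ord.
  by rewrite big_distrr.
have draw k red : m (incr_at k j) * urn_mean a b c d n
      (step (\sum_i (u i).1, \sum_i (u i).2)%N red) (fun w => f (s * u2 a b c R w)) =
    moment_mean m n (incr_at k j) (forest_mean s f (update u k (step (u k) red))).
  rewrite (step_sum u k) IH// => i; rewrite /update /incr_at.
  have [->|ik] := eqVneq i k; last by rewrite addn0.
  rewrite addn1 mulnS addnCA -uj /urn_step.
  by case: red => /=; rewrite -?abS -?cdS; lia.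
set w0 := (_, _) in draw *.
pose A := urn_mean a b c d n (step w0 true) (fun w => f (s * u2 a b c R w)).
pose B := urn_mean a b c d n (step w0 false) (fun w => f (s * u2 a b c R w)).
pose U : R := (w0.1 + w0.2)%N%:R.
transitivity (m j * (w0.1%:R / U * A + w0.2%:R / U * B)); first by [].
transitivity (\sum_k ((u k).1%:R * (m j / U) * A + (u k).2%:R * (m j / U) * B)).
  by rewrite big_split/= -!mulr_suml -!natr_sum; ring.
rewrite [RHS]/=; apply: eq_bigr => k _.
have -> : (fun i => forest_mean s f u (incr_at k i)) = _ :=
  funext (forest_mean_step s f u k).
rewrite moment_mean_linear -!draw -/A -/B uj.
have U0 : U != 0 by rewrite /U tot pnatr_eq0; have := ltn_ord k; lia.
have T0 : (1 + S * j k)%:R != 0 :> R by rewrite pnatr_eq0.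
have -> : m (incr_at k j) = (1 + S * j k)%:R * m j / U.
  by rewrite -mE -tot -/U mulrAC mulfV// mul1r.
move: T0 U0; clearbody U A B; move: (1 + S * j k)%:R => T T0 U0.
by field; rewrite T0 U0.
Qed.
End Forest.

(** * Expectations of bounded functions, and the law of the draws *)

Section BoundedMeasurable.
Context d (T : measurableType d) (R : realType).
Implicit Types f g : T -> R.

Definition bounded_measurable f :=
  measurable_fun setT f /\ exists M, forall x, `|f x| <= M.

Lemma bounded_measurable_cst (r : R) : bounded_measurable (fun _ : T => r).
Proof. by split; [exact: measurable_cst|exists `|r|]. Qed.

Lemma bounded_measurableM f g : bounded_measurable f -> bounded_measurable g ->
  bounded_measurable (fun x => f x * g x).
Proof.
move=> [mf [M fM]] [mg [M' gM']]; split; first exact: measurable_funM.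
by exists (M * M') => x; rewrite normrM ler_pM.
Qed.

Lemma bounded_measurableD f g : bounded_measurable f -> bounded_measurable g ->
  bounded_measurable (fun x => f x + g x).
Proof.
move=> [mf [M fM]] [mg [M' gM']]; split; first exact: measurable_funD.
by exists (M + M') => x; rewrite (le_trans (ler_normD _ _))// lerD.
Qed.

Lemma bounded_measurableB f g : bounded_measurable f -> bounded_measurable g ->
  bounded_measurable (fun x => f x - g x).
Proof.
move=> [mf [M fM]] [mg [M' gM]]; split; first exact: measurable_funB.
exists (M + M') => x; rewrite (le_trans (ler_normB _ _))// lerD//.
Qed.

Lemma bounded_measurable_norm f : bounded_measurable f ->
  bounded_measurable (fun x => `|f x|).
Proof.
move=> [mf [M fM]]; split; first exact: measurableT_comp.
by exists M => x; rewrite normr_id.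
Qed.

Lemma bounded_measurable_sum (I : Type) (s : seq I) (F : I -> T -> R) :
  (forall i, bounded_measurable (F i)) -> bounded_measurable (fun x => \sum_(i <- s) F i x).
Proof.
move=> bF; elim: s => [|i s IH].
  by under eq_fun do rewrite big_nil; exact: bounded_measurable_cst.
by under eq_fun do rewrite big_cons; exact: bounded_measurableD.
Qed.

Lemma bounded_measurable_prod (I : Type) (s : seq I) (F : I -> T -> R) :
  (forall i, bounded_measurable (F i)) -> bounded_measurable (fun x => \prod_(i <- s) F i x).
Proof.
move=> bF; elim: s => [|i s IH].
  by under eq_fun do rewrite big_nil; exact: bounded_measurable_cst.
by under eq_fun do rewrite big_cons; exact: bounded_measurableM.
Qed.

Lemma bounded_measurableX f n : bounded_measurable f -> bounded_measurable (fun x => f x ^+ n).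
Proof.
move=> bf; elim: n => [|n IH].
  by under eq_fun do rewrite expr0; exact: bounded_measurable_cst.
by under eq_fun do rewrite exprS; exact: bounded_measurableM.
Qed.
Lemma bounded_measurable_min f : measurable_fun setT f ->
  bounded_measurable (fun w => Num.min 1 `|f w|).
Proof.
move=> mf; split.
  apply: measurable_minr; first exact: measurable_cst.
  exact: measurableT_comp.
by exists 1 => w; rewrite ger0_norm ?ge_min ?lexx// le_min ler01 normr_ge0.
Qed.

End BoundedMeasurable.

Section Expectation.
Context d (T : measurableType d) (R : realType) (P : probability T R).
Implicit Types f g : T -> R.

Lemma bounded_measurable_integrable f : bounded_measurable f ->
  P.-integrable setT (EFin \o f).
Proof.
move=> [mf [M fM]]; apply: (@le_integrable _ _ _ P _ measurableT _ (cst M%:E)).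
- exact/measurable_EFinP.
- by move=> x _ /=; rewrite lee_fin (le_trans (fM x))// ler_norm.
- exact: finite_measure_integrable_cst.
Qed.

Lemma Rintegral_sum (I : Type) (r : seq I) (F : I -> T -> R) :
  (forall i, P.-integrable setT (EFin \o F i)) ->
  \int[P]_x (\sum_(i <- r) F i x) = \sum_(i <- r) \int[P]_x F i x.
Proof.
move=> iF; elim: r => [|i r IH].
  under eq_Rintegral do rewrite big_nil.
  by rewrite big_nil Rintegral_cst// mul0r.
under eq_Rintegral do rewrite big_cons.
rewrite RintegralD// ?IH ?big_cons//.
rewrite (_ : EFin \o _ = (fun x => \sum_(i <- r) (F i x)%:E)%E).
  by apply: integrable_sum => // l _; exact: iF.
by apply/funext => x /=; rewrite sumEFin.
Qed.

Lemma Rintegral_prob_cst (r : R) : \int[P]_x r = r.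
Proof.
rewrite Rintegral_cst// -[RHS]mulr1; congr (_ * _).
exact: (congr1 fine (probability_setT P)).
Qed.

Lemma Rintegral_indicator (A : set T) : measurable A -> \int[P]_x \1_A x = fine (P A).
Proof. by move=> mA; rewrite /Rintegral integral_indic// setIT. Qed.

Lemma le_Rintegral_bounded f g : bounded_measurable f -> bounded_measurable g ->
  (forall w, f w <= g w) -> \int[P]_w f w <= \int[P]_w g w.
Proof.
by move=> bf bg fg; apply: le_Rintegral => //; exact: bounded_measurable_integrable.
Qed.

Lemma normr_Rintegral_sub f g : bounded_measurable f -> bounded_measurable g ->
  `|\int[P]_x f x - \int[P]_x g x| <= \int[P]_x `|f x - g x|.
Proof.
move=> bf bg; rewrite -RintegralB//; try exact: bounded_measurable_integrable.
apply: le_normr_Rintegral => //.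
exact: (bounded_measurable_integrable (bounded_measurableB bf bg)).
Qed.

Lemma bounded_convergence (f_ : nat -> T -> R) f (M : R) :
  (forall n, measurable_fun setT (f_ n)) -> measurable_fun setT f ->
  {ae P, forall x n, `|f_ n x| <= M} ->
  {ae P, forall x, f_ ^~ x @ \oo --> f x} ->
  (\int[P]_x f_ n x) @[n --> \oo] --> \int[P]_x f x.
Proof.
move=> mf_ mf bf_ cf.
have [] := @dominated_convergence _ _ _ P _ measurableT
   (fun n x => (f_ n x)%:E) (EFin \o f) (cst M%:E).
- by move=> n; exact/measurable_EFinP.
- exact/measurable_EFinP.
- by apply: filterS cf => x cfx _; apply: cvg_EFin => //; exact: nearW.
- exact: finite_measure_integrable_cst.
- by apply: filterS bf_ => x bx n _ /=; rewrite lee_fin.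
move=> intf _ cvgf; apply: fine_cvg.
by rewrite fineK//; exact: integrable_fin_num.
Qed.

End Expectation.

Section UrnExpectation.
Context {R : realType} (a b c d : nat).
Context dO (O : measurableType dO) (P : probability O R).
Variables (u0 : nat * nat) (draw : nat -> {RV P >-> bool}).
Hypothesis urn : urn_draws a b c d u0 draw.
Hypothesis u0_gt0 : (0 < u0.1 + u0.2)%N.
Local Notation step := (urn_step a b c d).

Local Arguments draw_history : simpl never.

Lemma draw_historyS n w : draw_history draw n.+1 w = rcons (draw_history draw n w) (draw n w).
Proof. by rewrite /draw_history mkseqS. Qed.

Lemma measurable_draw_history n s : measurable [set w | draw_history draw n w = s].
Proof.
elim: n s => [|n IH] s.
  have [->|s0] := eqVneq s [::].
    by rewrite [X in measurable X](_ : _ = setT) //; apply/seteqP.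
  rewrite [X in measurable X](_ : _ = set0)//; apply/seteqP; split => // w /= E.
  by move: s0; rewrite -E.
case/lastP: s => [|s e].
  rewrite [X in measurable X](_ : _ = set0)//; apply/seteqP; split => // w.
rewrite [X in measurable X](_ : _ =
    [set w | draw_history draw n w = s] `&` (draw n @^-1` [set e])); last first.
  apply/seteqP; split => w; rewrite /= draw_historyS.
    by move=> /rcons_inj[].
  by move=> [-> ->].
by apply: measurableI => //; rewrite -[X in measurable X]setTI; exact: measurable_funP.
Qed.

Lemma urn_process_sum (g : nat * nat -> R) n w :
  g (urn_process a b c d u0 draw n w) = \sum_(s : n.-tuple bool)
    g (urn_composition a b c d u0 s) * \1_[set w | draw_history draw n w = s] w.
Proof.
rewrite (bigD1 [tuple of draw_history draw n w])//= indicE mem_set// mulr1.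
rewrite big1 ?addr0//= => s sw; rewrite indicE memNset ?mulr0//= => E.
by move/eqP: sw; apply; apply: val_inj.
Qed.

Definition next_mean (g : nat * nat -> R) (u : nat * nat) : R :=
  u.1%:R / (u.1 + u.2)%:R * g (step u true) + u.2%:R / (u.1 + u.2)%:R * g (step u false).

(** [urn_mean] conditions on the first draw, whereas the law of the draws is
given by conditioning the last one on the past. *)
Lemma urn_mean_last n u g :
  urn_mean a b c d n.+1 u g = urn_mean a b c d n u (next_mean g).
Proof.
elim: n u => [//|n IH] u.
transitivity (u.1%:R / (u.1 + u.2)%:R * urn_mean a b c d n.+1 (step u true) g +
  u.2%:R / (u.1 + u.2)%:R * urn_mean a b c d n.+1 (step u false) g); first by [].
by rewrite !IH.
Qed.

Lemma urn_composition_gt0 (s : seq bool) :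
  (0 < (urn_composition a b c d u0 s).1 + (urn_composition a b c d u0 s).2)%N.
Proof.
rewrite /urn_composition; elim: s (u0) u0_gt0 => [//|e s IH] u u_gt0 /=.
by apply: IH; case: e => /=; move: u_gt0; lia.
Qed.

Let integrable_indicator (A : set O) (r : R) : measurable A ->
  P.-integrable setT (EFin \o (fun w => r * \1_A w)).
Proof.
move=> mA; apply: bounded_measurable_integrable; apply: bounded_measurableM.
  exact: bounded_measurable_cst.
split; first exact: measurable_indic.
by exists 1 => w; rewrite indicE; case: (_ \in _); rewrite ?normr1 ?normr0.
Qed.

Let Rintegral_indicator_scale (A : set O) (r : R) : measurable A ->
  \int[P]_w (r * \1_A w) = r * fine (P A).
Proof.
move=> mA; rewrite RintegralZl//; first by rewrite Rintegral_indicator.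
by have := integrable_indicator 1 mA; under eq_fun do rewrite mul1r.
Qed.

(** Sum over the possible histories of the first [n] draws and the colour of the
next one. *)
Lemma urn_expectation n (g : nat * nat -> R) :
  \int[P]_w g (urn_process a b c d u0 draw n w) = urn_mean a b c d n u0 g.
Proof.
elim: n g => [|n IH] g.
  by rewrite -[RHS](Rintegral_prob_cst P).
rewrite urn_mean_last -IH.
pose u (s : n.-tuple bool) := urn_composition a b c d u0 s.
pose H (s : n.-tuple bool) := [set w | draw_history draw n w = s].
pose D e := draw n @^-1` [set e].
have mH s : measurable (H s) by exact: measurable_draw_history.
have mD e : measurable (D e).
  by rewrite -[X in measurable X]setTI; exact: measurable_funP.
have drawE e s : fine (P (H s `&` D e)) =
    fine (P (H s)) * ((if e then (u s).1 else (u s).2)%:R / ((u s).1 + (u s).2)%:R).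
  have drawT : fine (P (H s `&` D true)) =
      fine (P (H s)) * ((u s).1%:R / ((u s).1 + (u s).2)%:R).
    have -> : P (H s `&` D true) =
        (P (H s) * ((u s).1%:R / ((u s).1 + (u s).2)%:R)%:E)%E := urn s.
    by rewrite fineM// fin_num_measure.
  case: e => //.
  have : fine (P (H s `&` D true)) + fine (P (H s `&` D false)) = fine (P (H s)).
    rewrite -fineD ?fin_num_measure//; try exact: measurableI.
    rewrite -measureU//; try exact: measurableI.
      rewrite -setIUr; congr (fine (P _)); apply/setIidPl => w _.
      by rewrite /D/=; case: (draw n w); [left|right].
    by apply/seteqP; split => // w [[_ +] [_ +]]; rewrite /D/= => ->.
  rewrite drawT => /(canRL (addKr _)) ->.
  have /lt0r_neq0 u0' : 0 < ((u s).1 + (u s).2)%:R :> R.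
    by rewrite ltr0n; exact: urn_composition_gt0.
  by move: u0'; rewrite natrD => u0'; field.
transitivity (\sum_(s : n.-tuple bool) (
    g (step (u s) true) * fine (P (H s `&` D true)) +
    g (step (u s) false) * fine (P (H s `&` D false)))).
  rewrite (_ : (fun w => g _) = fun w => \sum_(s : n.-tuple bool) \sum_(e : bool)
      g (step (u s) e) * \1_(H s `&` D e) w); last first.
    apply/funext => w.
    rewrite (bigD1 [tuple of draw_history draw n w])//= (bigD1 (draw n w))//=.
    rewrite indicE mem_set// mulr1 big1 ?addr0; last first.
      by move=> e ew; rewrite indicE memNset ?mulr0// => -[_ E]; move: ew; rewrite -E eqxx.
    rewrite big1 ?addr0; last first.
      move=> s sw; apply: big1 => e _; rewrite indicE memNset ?mulr0// => -[E _].
      by move/eqP: sw; apply; apply: val_inj.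
    by rewrite /urn_process draw_historyS /urn_composition -cats1 foldl_cat.
  under eq_Rintegral do rewrite pair_bigA.
  rewrite Rintegral_sum => [|[s e]]; last exact/integrable_indicator/measurableI.
  rewrite -(pair_bigA _ (fun s e => \int[P]_w (g (step (u s) e) * \1_(H s `&` D e) w)))/=.
  apply: eq_bigr => s _; rewrite big_bool.
  by rewrite !Rintegral_indicator_scale//; exact: measurableI.
rewrite (_ : (fun w => next_mean _ _) = fun w => \sum_(s : n.-tuple bool)
   next_mean g (u s) * \1_(H s) w); last by apply/funext => w; rewrite urn_process_sum.
rewrite Rintegral_sum => [|s]; last exact/integrable_indicator.
apply: eq_bigr => s _; rewrite Rintegral_indicator_scale// !drawE /next_mean; ring.
Qed.

Lemma measurable_urn_process (g : nat * nat -> R) n :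
  measurable_fun setT (fun w => g (urn_process a b c d u0 draw n w)).
Proof.
under eq_fun do rewrite urn_process_sum.
apply: measurable_sum => s; apply: measurable_funM; first exact: measurable_cst.
by apply: measurable_indic; exact: measurable_draw_history.
Qed.

End UrnExpectation.

(** * Lipschitz test functions and convolutions *)

Section TestFunctions.
Context {R : realType}.
Implicit Types phi psi : R -> R.

Definition test_function (L : R) phi :=
  (forall x, 0 <= phi x <= 1) /\ (forall x y, `|phi x - phi y| <= L * `|x - y|).

Lemma test_function_continuous L phi : test_function L phi -> continuous phi.
Proof.
move=> [_ lip] x; apply/cvgrPdist_le => /= e e0.
have L1 : 0 < `|L| + 1 by rewrite ltr_pwDr.
near=> y; apply: (le_trans (lip _ _)).
have : `|x - y| <= e / (`|L| + 1).
  by near: y; apply: cvgr_dist_le; [exact: cvg_id|rewrite divr_gt0].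
rewrite ler_pdivlMr// mulrC; apply: le_trans; apply: ler_wpM2r => //.
by rewrite (le_trans (ler_norm L))// lerDl.
Unshelve. all: by end_near. Qed.

Lemma test_function_measurable L phi : test_function L phi -> measurable_fun setT phi.
Proof. by move=> /test_function_continuous; exact: continuous_measurable_fun. Qed.
End TestFunctions.

Section ShiftMean.
Context {R : realType} d (T : measurableType d) (P : probability T R).
Implicit Types (Z : T -> R) (phi : R -> R).

(** The convolution operator of the law of [Z], acting on functions. *)
Definition shift_mean Z phi (x : R) : R := \int[P]_w phi (x + Z w).

(** A truncated L1 distance: it metrizes convergence in probability. *)
Definition truncated_dist Z Z' : R := \int[P]_w Num.min 1 `|Z w - Z' w|.

Lemma bounded_measurable_shift L Z phi x : test_function L phi ->
  measurable_fun setT Z -> bounded_measurable (fun w => phi (x + Z w)).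
Proof.
move=> tphi mZ; split.
  apply: (measurableT_comp (test_function_measurable tphi)).
  by apply: measurable_funD => //; exact: measurable_cst.
by exists 1 => w; have /andP[p0 p1] := tphi.1 (x + Z w); rewrite ger0_norm.
Qed.

Lemma test_function_shift_mean L Z phi : test_function L phi ->
  measurable_fun setT Z -> test_function L (shift_mean Z phi).
Proof.
move=> tphi mZ; have bphi x := bounded_measurable_shift x tphi mZ; split => [x|x y].
  apply/andP; split; first by apply: Rintegral_ge0 => w _; have /andP[] := tphi.1 (x + Z w).
  rewrite -(Rintegral_prob_cst P 1); apply: le_Rintegral_bounded => //.
    exact: bounded_measurable_cst.
  by move=> w; have /andP[] := tphi.1 (x + Z w).
apply: (le_trans (normr_Rintegral_sub P (bphi x) (bphi y))).
rewrite -(Rintegral_prob_cst P (L * _)); apply: le_Rintegral_bounded.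
- exact: (bounded_measurable_norm (bounded_measurableB (bphi x) (bphi y))).
- exact: bounded_measurable_cst.
- by move=> w; apply: (le_trans (tphi.2 _ _)); rewrite opprD addrACA subrr addr0.
Qed.

Lemma shift_mean_contract L Z phi psi e x : test_function L phi -> test_function L psi ->
  measurable_fun setT Z -> (forall y, `|phi y - psi y| <= e) ->
  `|shift_mean Z phi x - shift_mean Z psi x| <= e.
Proof.
move=> tphi tpsi mZ He.
have bphi := bounded_measurable_shift x tphi mZ.
have bpsi := bounded_measurable_shift x tpsi mZ.
apply: (le_trans (normr_Rintegral_sub P bphi bpsi)).
rewrite -(Rintegral_prob_cst P e); apply: le_Rintegral_bounded => //.
- exact: (bounded_measurable_norm (bounded_measurableB bphi bpsi)).
- exact: bounded_measurable_cst.
Qed.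

Lemma shift_mean_dist L Z Z' phi x : test_function L phi -> 1 <= L ->
  measurable_fun setT Z -> measurable_fun setT Z' ->
  `|shift_mean Z phi x - shift_mean Z' phi x| <= L * truncated_dist Z Z'.
Proof.
move=> tphi L1 mZ mZ'.
have L0 : 0 <= L by exact: le_trans L1.
have bphi := bounded_measurable_shift x tphi mZ.
have bphi' := bounded_measurable_shift x tphi mZ'.
have bmin : bounded_measurable (fun w => Num.min 1 `|Z w - Z' w|).
  by apply: bounded_measurable_min; exact: measurable_funB.
apply: (le_trans (normr_Rintegral_sub P bphi bphi')).
rewrite -RintegralZl//; last exact: bounded_measurable_integrable.
apply: le_Rintegral_bounded.
- exact: (bounded_measurable_norm (bounded_measurableB bphi bphi')).
- by apply: bounded_measurableM => //; exact: bounded_measurable_cst.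
move=> w; rewrite minr_pMr// mulr1 le_min; apply/andP; split.
  apply: le_trans L1.
  have /andP[? ?] := tphi.1 (x + Z w); have /andP[? ?] := tphi.1 (x + Z' w).
  by rewrite ler_norml; apply/andP; split; lra.
by apply: (le_trans (tphi.2 _ _)); rewrite opprD addrACA subrr add0r.
Qed.

Lemma truncated_dist_triangle Z1 Z2 Z3 : measurable_fun setT Z1 ->
  measurable_fun setT Z2 -> measurable_fun setT Z3 ->
  truncated_dist Z1 Z3 <= truncated_dist Z1 Z2 + truncated_dist Z2 Z3.
Proof.
move=> m1 m2 m3.
have b Z Z' : measurable_fun setT Z -> measurable_fun setT Z' ->
    bounded_measurable (fun w : T => Num.min 1 `|Z w - Z' w| : R).
  by move=> mZ mZ'; apply: bounded_measurable_min; exact: measurable_funB.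
rewrite /truncated_dist -RintegralD//; try exact/bounded_measurable_integrable/b.
apply: le_Rintegral_bounded; first exact: b.
  by apply: bounded_measurableD; exact: b.
move=> w.
have := ler_distD (Z2 w) (Z1 w) (Z3 w).
have := normr_ge0 (Z1 w - Z2 w); have := normr_ge0 (Z2 w - Z3 w).
move: `|_ - _| `|_ - _| `|_ - _| => x y z.
by rewrite !minEle; do 3 case: ifP => /= ?; lra.
Qed.

Lemma cvg_min_norm0 (u : nat -> R) : u @ \oo --> 0 ->
  Num.min 1 `|u n| @[n --> \oo] --> 0.
Proof.
move=> u0; apply: (@squeeze_cvgr _ _ _ _ (cst 0) (fun n => `|u n|)).
- apply: nearW => n /=; rewrite le_min ler01 normr_ge0/=.
  by rewrite ge_min lexx orbT.
- exact: cvg_cst.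
- by rewrite -(@normr0 _ R); exact: cvg_norm.
Qed.

(** A finite random variable multiplied by small numbers tends to zero in
probability. *)
Lemma truncated_dist_scale (G : T -> R) (e : R) : measurable_fun setT G -> 0 < e ->
  exists2 eta, 0 < eta & forall t, `|t| <= eta -> \int[P]_w Num.min 1 `|t * G w| <= e.
Proof.
move=> mG e0.
have mt (t : R) : measurable_fun setT (fun w => t * G w).
  by apply: measurable_funM => //; exact: measurable_cst.
have : \int[P]_w Num.min 1 `|harmonic n * G w| @[n --> \oo] --> \int[P]_w (0 : R).
  apply: (@bounded_convergence _ _ _ _ _ _ 1).
  - by move=> n; exact: (bounded_measurable_min (mt _)).1.
  - exact: measurable_cst.
  - apply: aeW => w n.
    by rewrite ger0_norm ?ge_min ?lexx// le_min ler01 normr_ge0.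
  - apply: aeW => w.
    apply: cvg_min_norm0; rewrite -[X in _ --> X](mul0r (G w)).
    by apply: cvgMl; exact: cvg_harmonic.
rewrite Rintegral_prob_cst => /cvgr_le/(_ _ e0)[n _ /(_ n (leqnn n)) /= Hn].
exists (harmonic n); first exact: harmonic_gt0.
move=> t tn; apply: le_trans Hn; apply: le_Rintegral_bounded.
- exact: bounded_measurable_min.
- exact: bounded_measurable_min.
move=> w; rewrite le_min ge_min lexx/= ge_min; apply/orP; right.
by rewrite !normrM ler_wpM2r// (le_trans tn)// ler_norm.
Qed.

End ShiftMean.

(** * Convergence of one urn, uniformly in the number of draws *)

Section Holder.
Context {R : realType}.

(** Since [t <= t ^ s] for [t] in [0,1], applied to [x / (x + y)] and
[y / (x + y)]. *)
Lemma powR_subadditive (s x y : R) : 0 < s <= 1 -> 0 <= x -> 0 <= y ->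
  (x + y) `^ s <= x `^ s + y `^ s.
Proof.
move=> /andP[s0 s1] x0 y0.
have [->|x_neq0] := eqVneq x 0; first by rewrite add0r lerDr powR_ge0.
have [->|y_neq0] := eqVneq y 0; first by rewrite addr0 lerDl powR_ge0.
have {x0 x_neq0}x0 : 0 < x by rewrite lt_neqAle eq_sym x_neq0.
have {y0 y_neq0}y0 : 0 < y by rewrite lt_neqAle eq_sym y_neq0.
have z0 : 0 < x + y by exact: addr_gt0.
have part (t : R) : 0 < t -> t <= x + y -> t / (x + y) * (x + y) `^ s <= t `^ s.
  move=> t0 tz; have tE : t = t / (x + y) * (x + y) by rewrite divfK// gt_eqF.
  rewrite [in leRHS]tE powRM; last 2 first.
  - by rewrite divr_ge0 ?ltW.
  - exact: ltW.
  apply: ler_wpM2r; first exact: powR_ge0.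
  by apply: ger1_powR => //; rewrite divr_gt0//= ler_pdivrMr// mul1r.
have px := part x x0 (ler_wpDr (ltW y0) (lexx x)).
have py := part y y0 (ler_wpDl (ltW x0) (lexx y)).
apply: le_trans (lerD px py).
by rewrite -mulrDl -mulrDl divff ?gt_eqF// mul1r.
Qed.

Lemma powR_holder (s x y : R) : 0 < s <= 1 -> 0 <= x -> 0 <= y ->
  `|x `^ s - y `^ s| <= `|x - y| `^ s.
Proof.
move=> s01; have /andP[s0 _] := s01.
wlog yx : x y / y <= x.
  move=> H x0 y0; have [yx|/ltW xy] := leP y x; first exact: H.
  by rewrite distrC [`|x - y|]distrC; exact: H.
move=> x0 y0; rewrite [`|x - y|]ger0_norm ?subr_ge0// ger0_norm ?subr_ge0; last first.
  by apply: ge0_ler_powR; rewrite ?nnegrE// ltW.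
rewrite lerBlDr; apply: le_trans (powR_subadditive s01 _ y0); rewrite ?subr_ge0//.
by rewrite subrK.
Qed.
End Holder.

Section UrnUniform.
Context {R : realType} (a b c d : nat).
Context dO (O : measurableType dO) (P : probability O R).
Variables (u0 : nat * nat) (draw : nat -> {RV P >-> bool}) (sigma : R) (W : {RV P >-> R}).
Hypothesis sigma01 : 0 < sigma <= 1.
Hypothesis limW : urn_limit a b c d sigma u0 draw W.
Let U (j : nat) (w : O) : R := u2 a b c R (urn_process a b c d u0 draw j w).

Let mU j : measurable_fun setT (U j).
Proof. exact: measurable_urn_process. Qed.

Let mW : measurable_fun setT (W : O -> R).
Proof. exact: measurable_funP. Qed.

Lemma urn_limit_in_probability (e : R) : 0 < e ->
  exists2 J, (0 < J)%N & forall j, (J <= j)%N ->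
    truncated_dist P (fun w => U j w / j%:R `^ sigma) W <= e.
Proof.
move=> e0.
have mD n : measurable_fun setT (fun w => U n w / n%:R `^ sigma - W w).
  by apply: measurable_funB => //; apply: measurable_funM => //; exact: measurable_cst.
have : truncated_dist P (fun w => U n w / n%:R `^ sigma) W @[n --> \oo] --> \int[P]_w (0 : R).
  apply: (@bounded_convergence _ _ _ _ _ _ 1).
  - by move=> n; exact: (bounded_measurable_min (mD n)).1.
  - exact: measurable_cst.
  - apply: aeW => w n.
    by rewrite ger0_norm ?ge_min ?lexx// le_min ler01 normr_ge0.
  - apply: filterS limW => w Ww; apply: cvg_min_norm0.
    by rewrite -(subrr (W w)); apply: cvgB => //; exact: cvg_cst.
rewrite Rintegral_prob_cst => /cvgr_le/(_ _ e0)[J _ HJ].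
by exists J.+1 => // j Jj; apply: HJ => /=; exact: ltnW.
Qed.

(** The number [j] of draws and the scale [n] are decoupled. When [j] is large
the urn is close to [j ^ sigma * W], and dividing by a comparable [n ^ sigma]
keeps it so; when [j] stays below a threshold, finitely many random variables
are divided by the large [n ^ sigma]. Moving from [j / n] to [v] uses that
powers are Holder continuous. *)
Lemma urn_limit_uniform (e : R) : 0 < e -> exists2 delta, 0 < delta &
  exists n0, forall n j v, (n0 <= n)%N -> 0 <= v <= 1 ->
    `|j%:R / n.+1%:R - v| <= delta ->
    truncated_dist P (fun w => (n.+1%:R `^ sigma)^-1 * U j w)
      (fun w => v `^ sigma * W w) <= e.
Proof.
move=> e0; have /andP[s0 s1] := sigma01.
have e4 : 0 < e / 4 by rewrite divr_gt0.
have e8 : 0 < e / 8 by rewrite divr_gt0.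
have [J J0 HJ] := urn_limit_in_probability e8.
have [eta eta0 Heta] := truncated_dist_scale P mW e4.
pose G w := \sum_(j < J) `|U j w - j%:R `^ sigma * W w|.
have mUW j : measurable_fun setT (fun w => U j w - j%:R `^ sigma * W w).
  by apply: measurable_funB => //; apply: measurable_funM => //; exact: measurable_cst.
have mG : measurable_fun setT G.
  by apply: measurable_sum => j; exact: measurableT_comp.
have [eta' eta'0 Heta'] := truncated_dist_scale P mG e4.
(* [delta <= 1] will give [j / n.+1 <= 2], and the other bound that
[delta ^ sigma <= eta]. *)
pose delta := Num.min 1 (eta `^ sigma^-1).
have delta0 : 0 < delta by rewrite lt_min ltr01 powR_gt0.
have delta_eta : delta `^ sigma <= eta.
  apply: (@le_trans _ _ ((eta `^ sigma^-1) `^ sigma)).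
    by apply: ge0_ler_powR; rewrite ?nnegrE ?ge_min ?lexx ?orbT ?powR_ge0//; exact: ltW.
  by rewrite -powRrM mulVf ?gt_eqF// powRr1// ltW.
exists delta => //.
have [n0 Hn0] : exists n0, forall n, (n0 <= n)%N -> (n.+1%:R `^ sigma)^-1 <= eta'.
  exists (Num.truncn (eta'^-1 `^ sigma^-1)) => n; rewrite truncn_le_nat => /ltW n0n.
  have eta'V : eta'^-1 = (eta'^-1 `^ sigma^-1) `^ sigma.
    by rewrite -powRrM mulVf ?gt_eqF// powRr1// invr_ge0 ltW.
  rewrite -[eta']invrK lef_pV2 ?posrE ?invr_gt0 ?powR_gt0// eta'V.
  by apply: ge0_ler_powR n0n; rewrite ?nnegrE ?powR_ge0// ltW.
exists n0 => n j v n0n /andP[v0 v1] jv.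
set s := (n.+1%:R `^ sigma)^-1.
have s_gt0 : 0 < s by rewrite invr_gt0 powR_gt0.
have sj : s * j%:R `^ sigma = (j%:R / n.+1%:R) `^ sigma.
  by rewrite powRM// -powR_inv1// -powRrM mulN1r powRN mulrC.
have msU : measurable_fun setT (fun w => s * U j w).
  by apply: measurable_funM => //; exact: measurable_cst.
have mcW (t : R) : measurable_fun setT (fun w => t * W w).
  by apply: measurable_funM => //; exact: measurable_cst.
apply: (le_trans (truncated_dist_triangle P msU (mcW (s * j%:R `^ sigma)) (mcW (v `^ sigma)))).
have -> : e = (e / 4 + e / 4) + e / 2 by field.
rewrite -[leLHS]addr0; apply: lerD; last by rewrite divr_ge0 ?ltW.
apply: lerD; last first.
  rewrite /truncated_dist; under eq_Rintegral do rewrite -mulrBl.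
  apply: Heta; apply: le_trans delta_eta; rewrite sj.
  apply: (le_trans (powR_holder sigma01 _ v0)); first by rewrite divr_ge0.
  by apply: ge0_ler_powR; rewrite ?nnegrE//; exact: ltW.
(* Below the threshold [J], all errors are dominated by the single variable
[G], which the scale [n ^ sigma] makes small. *)
have [jJ|Jj] := ltnP j J.
  apply: (@le_trans _ _ (\int[P]_w Num.min 1 `|s * G w|)); last first.
    by apply: Heta'; rewrite gtr0_norm//; exact: Hn0.
  apply: le_Rintegral_bounded.
  - by apply: bounded_measurable_min; exact: measurable_funB.
  - by apply: bounded_measurable_min; apply: measurable_funM => //; exact: measurable_cst.
  move=> w; rewrite le_min ge_min lexx/= ge_min; apply/orP; right.
  rewrite -mulrA -mulrBr !normrM ler_wpM2l//.
  rewrite [leRHS]ger0_norm; last by apply: sumr_ge0.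
  by rewrite /G (bigD1 (Ordinal jJ))//= lerDl; apply: sumr_ge0.
have j0 : 0 < j%:R `^ sigma :> R by rewrite powR_gt0// ltr0n (leq_trans J0).
have le2 : s * j%:R `^ sigma <= 2.
  rewrite sj; have jn : j%:R / n.+1%:R <= 2 :> R.
    have delta1 : delta <= 1 by rewrite ge_min lexx.
    move: jv; rewrite ler_norml => /andP[_].
    by rewrite lerBlDr => /le_trans; apply; rewrite (_ : 2 = 1 + 1)// lerD.
  apply: (@le_trans _ _ (2 `^ sigma)).
    by apply: ge0_ler_powR; rewrite ?nnegrE ?divr_ge0//; exact: ltW.
  by apply: ler1_powR => //; rewrite ler1n.
have -> : e / 4 = 2 * (e / 8) by field.
apply: (@le_trans _ _ (2 * truncated_dist P (fun w => U j w / j%:R `^ sigma) W)); last first.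
  by rewrite ler_wpM2l// HJ.
have mD : measurable_fun setT (fun w => U j w / j%:R `^ sigma - W w).
  by apply: measurable_funB => //; apply: measurable_funM => //; exact: measurable_cst.
have bD := bounded_measurable_min mD.
rewrite /truncated_dist -RintegralZl//; last exact: bounded_measurable_integrable.
apply: le_Rintegral_bounded.
- by apply: bounded_measurable_min; exact: measurable_funB.
- by apply: bounded_measurableM => //; exact: bounded_measurable_cst.
move=> w; rewrite (_ : s * U j w - _ =
    s * j%:R `^ sigma * (U j w / j%:R `^ sigma - W w)); last first.
  by field; rewrite gt_eqF.
rewrite normrM [`|s * _|]gtr0_norm ?mulr_gt0//.
have := normr_ge0 (U j w / j%:R `^ sigma - W w).
move: `|U j w / _ - _| => y y0.
have : s * j%:R `^ sigma * y <= 2 * y by rewrite ler_wpM2r.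
by move: (s * _ * y) => z; rewrite !minEle; do 2 case: ifP => /= ?; lra.
Qed.

End UrnUniform.

(** * Multinomial means and their limits *)

Section Multinomial.
Context {R : realType} {N : nat}.
Implicit Types (v : 'I_N -> R) (j : 'I_N -> nat) (g h : ('I_N -> nat) -> R).

Lemma multinomial_mean_linear n v (p q : R) g h :
  multinomial_mean n v (fun j => p * g j + q * h j) =
  p * multinomial_mean n v g + q * multinomial_mean n v h.
Proof.
elim: n g h => [//|n IH] g h /=.
rewrite !mulr_sumr -big_split/=; apply: eq_bigr => k _; rewrite IH; ring.
Qed.

Section Weights.
Variable v : 'I_N -> R.
Hypotheses (v0 : forall k, 0 <= v k) (v1 : \sum_k v k = 1).

Lemma multinomial_mean_le n g h : (forall j, g j <= h j) ->
  multinomial_mean n v g <= multinomial_mean n v h.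
Proof.
elim: n g h => [|n IH] g h gh /=; first exact: gh.
by apply: ler_sum => k _; apply: ler_wpM2l => //; apply: IH.
Qed.

Lemma multinomial_mean_cst n (r : R) : multinomial_mean n v (fun=> r) = r.
Proof. by elim: n => [//|n IH] /=; rewrite IH -mulr_suml v1 mul1r. Qed.

Lemma multinomial_mean_sum n (I : Type) (s : seq I) (F : I -> ('I_N -> nat) -> R) :
  multinomial_mean n v (fun j => \sum_(i <- s) F i j) =
  \sum_(i <- s) multinomial_mean n v (F i).
Proof.
elim: s => [|i s IH].
  rewrite big_nil -[RHS](multinomial_mean_cst n); congr multinomial_mean.
  by apply/funext => j; rewrite big_nil.
rewrite big_cons -IH -[X in X + _]mul1r -[X in _ + X]mul1r -multinomial_mean_linear.
by congr multinomial_mean; apply/funext => j; rewrite big_cons !mul1r.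
Qed.

(** The free centre [x] carries the induction: one draw moves it by one with
probability [v k]. *)
Lemma multinomial_mean_sqr n k (x : R) :
  multinomial_mean n v (fun j => ((j k)%:R + x) ^+ 2) =
  n%:R * (v k * (1 - v k)) + (n%:R * v k + x) ^+ 2.
Proof.
elim: n x => [|n IH] x /=; first by rewrite !mul0r !add0r.
have E l : multinomial_mean n v (fun j => ((incr_at l j k)%:R + x) ^+ 2) =
    n%:R * (v k * (1 - v k)) + (n%:R * v k + ((k == l)%:R + x)) ^+ 2.
  rewrite -IH; congr multinomial_mean; apply/funext => j.
  by rewrite /incr_at natrD addrA.
under eq_bigr do rewrite E.
rewrite (bigD1 k)//= eqxx mulr1n.
under eq_bigr => l lk do rewrite eq_sym (negbTE lk) add0r.
have rest : \sum_(l < N | l != k) v l = 1 - v k.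
  by rewrite -v1 [in RHS](bigD1 k)//= addrAC subrr add0r.
by rewrite -mulr_suml rest -natr1; ring.
Qed.

(** Where some coordinate is farther than [delta] from [v], the sum of the
squared deviations over [delta ^ 2] exceeds one, which bounds the distance of
[g j] to [h]; its mean is of order [1 / n]. *)
Lemma multinomial_mean_chebyshev n g (h e delta : R) : 0 < delta -> 0 <= e ->
  (forall j, 0 <= g j <= 1) -> 0 <= h <= 1 ->
  (forall j, (forall k, `|(j k)%:R / n.+1%:R - v k| <= delta) -> `|g j - h| <= e) ->
  `|multinomial_mean n v g - h| <= e + N%:R / (delta ^+ 2 * n.+1%:R).
Proof.
move=> delta0 e0 g01 h01 gh.
have d2 : 0 < delta ^+ 2 by rewrite exprn_gt0.
pose q j : R := \sum_k ((j k)%:R / n.+1%:R - v k) ^+ 2 / delta ^+ 2.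
have q_ge0 j : 0 <= q j.
  by apply: sumr_ge0 => k _; rewrite divr_ge0 ?sqr_ge0.
have main j : `|g j - h| <= e + q j.
  have [near_v|/existsNP[k /negP]] :=
    pselect (forall k, `|(j k)%:R / n.+1%:R - v k| <= delta).
    by rewrite (le_trans (gh j near_v))// lerDl.
  rewrite -ltNge => far.
  apply: (@le_trans _ _ 1).
    have /andP[g0 g1] := g01 j; have /andP[h0 h1] := h01.
    by rewrite ler_norml; apply/andP; split; lra.
  apply: (@le_trans _ _ (q j)); last by rewrite lerDr.
  rewrite /q (bigD1 k)//= -[leLHS]addr0 lerD//; last first.
    by apply: sumr_ge0 => l _; rewrite divr_ge0 ?sqr_ge0.
  rewrite ler_pdivlMr// mul1r -[leRHS]real_normK ?num_real// lerXn2r ?nnegrE//; exact: ltW.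
have qE : multinomial_mean n v q <= N%:R / (delta ^+ 2 * n.+1%:R).
  rewrite /q multinomial_mean_sum.
  apply: (@le_trans _ _ (\sum_(k < N) (delta ^+ 2 * n.+1%:R)^-1)); last first.
    by rewrite sumr_const card_ord mulr_natl.
  apply: ler_sum => k _.
  have n0 : n.+1%:R != 0 :> R by rewrite pnatr_eq0.
  rewrite (_ : (fun j => _) = (fun j : 'I_N -> nat =>
     (n.+1%:R ^+ 2 * delta ^+ 2)^-1 * ((j k)%:R + (- (n.+1%:R * v k))) ^+ 2 +
     0 * 0)); last first.
    apply/funext => j; move: (n.+1%:R) n0 => M n0.
    by field; rewrite n0 gt_eqF.
  rewrite (multinomial_mean_linear _ _ _ _ _ (fun=> 0)) multinomial_mean_sqr mul0r addr0.
  have vk1 : v k <= 1.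
    by rewrite -v1 (bigD1 k)//= lerDl; apply: sumr_ge0.
  have -> : (delta ^+ 2 * n.+1%:R)^-1 = (n.+1%:R ^+ 2 * delta ^+ 2)^-1 * n.+1%:R.
    by move: (n.+1%:R) n0 => M n0; field; rewrite n0 gt_eqF.
  apply: ler_wpM2l; first by rewrite invr_ge0 mulr_ge0 ?sqr_ge0.
  rewrite -natr1; have := v0 k; have := ler0n R n; move: (n%:R) (v k) vk1 => m x x1 m0 x0.
  by nra.
move: (N%:R / _) qE => C qE; rewrite ler_norml; apply/andP; split.
  have : multinomial_mean n v (fun j => 1 * (h - e) + (-1) * q j) <= multinomial_mean n v g.
    apply: multinomial_mean_le => j.
    by have := main j; rewrite ler_norml => /andP[? ?]; lra.
  by rewrite (multinomial_mean_linear _ _ _ _ (fun=> h - e) q) multinomial_mean_cst => ?; lra.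
have : multinomial_mean n v g <= multinomial_mean n v (fun j => 1 * (h + e) + 1 * q j).
  apply: multinomial_mean_le => j.
  by have := main j; rewrite ler_norml => /andP[? ?]; lra.
by rewrite (multinomial_mean_linear _ _ _ _ (fun=> h + e) q) multinomial_mean_cst => ?; lra.
Qed.
End Weights.
End Multinomial.

Section Telescoping.
Context {R : realType} {N : nat} (L : R).
Variables (A : 'I_N -> nat -> nat -> (R -> R) -> R -> R) (B : 'I_N -> R -> (R -> R) -> R -> R).
Hypothesis A_test : forall k n j phi, test_function L phi -> test_function L (A k n j phi).
Hypothesis B_test : forall k v phi, test_function L phi -> test_function L (B k v phi).
Hypothesis A_contract : forall k n j phi psi e x, test_function L phi ->
  test_function L psi -> (forall y, `|phi y - psi y| <= e) ->
  `|A k n j phi x - A k n j psi x| <= e.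
Hypothesis A_close_B : forall k e, 0 < e -> exists2 delta, 0 < delta &
  exists n0, forall n j v, (n0 <= n)%N -> 0 <= v <= 1 ->
    `|j%:R / n.+1%:R - v| <= delta -> forall phi x, test_function L phi ->
    `|A k n j phi x - B k v phi x| <= e.

Let PA n (r : seq 'I_N) (j : 'I_N -> nat) := operator_product r (fun k => A k n (j k)).
Let PB (r : seq 'I_N) (v : 'I_N -> R) := operator_product r (fun k => B k (v k)).

Lemma operator_product_test r (D : 'I_N -> (R -> R) -> R -> R) phi :
  (forall k psi, test_function L psi -> test_function L (D k psi)) ->
  test_function L phi -> test_function L (operator_product r D phi).
Proof. by move=> HD tphi; elim: r => [//|k r IH] /=; exact: HD. Qed.

(** Replacing the factors one at a time, each replacement costs little because
the remaining factors are contractions. *)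
Lemma operator_product_close (r : seq 'I_N) e : 0 < e -> exists2 delta, 0 < delta &
  exists n0, forall n j v, (n0 <= n)%N -> (forall k, 0 <= v k <= 1) ->
    (forall k, `|(j k)%:R / n.+1%:R - v k| <= delta) ->
    forall phi x, test_function L phi -> `|PA n r j phi x - PB r v phi x| <= e.
Proof.
elim: r e => [|k r IH] e e0.
  by exists 1 => //; exists 0%N => n j v _ _ _ phi x _; rewrite subrr normr0 ltW.
have e2 : 0 < e / 2 by rewrite divr_gt0.
have [d1 d10 [n1 H1]] := IH _ e2.
have [d2 d20 [n2 H2]] := A_close_B k e2.
exists (Num.min d1 d2); first by rewrite lt_min d10.
exists (maxn n1 n2) => n j v; rewrite geq_max => /andP[n1n n2n] v01 jv phi x tphi.
have jv1 l : `|(j l)%:R / n.+1%:R - v l| <= d1 by apply: le_trans (jv l) _; rewrite ge_min lexx.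
have jv2 l : `|(j l)%:R / n.+1%:R - v l| <= d2.
  by apply: le_trans (jv l) _; rewrite ge_min lexx orbT.
have tA : test_function L (PA n r j phi).
  by apply: operator_product_test => // l psi; exact: A_test.
have tB : test_function L (PB r v phi).
  by apply: operator_product_test => // l psi; exact: B_test.
rewrite (le_trans (ler_distD (A k n (j k) (PB r v phi) x) _ _))// [e in leRHS]splitr lerD//.
  by apply: A_contract => // y; exact: H1.
exact: H2.
Qed.

Lemma cvg_multinomial_mean v phi x : (forall k, 0 <= v k) -> \sum_k v k = 1 ->
  test_function L phi ->
  multinomial_mean n v (fun j => PA n (enum 'I_N) j phi x) @[n --> \oo] -->
  PB (enum 'I_N) v phi x.
Proof.
move=> v0 v1 tphi; apply/cvgrPdist_le => /= e e0.
have e2 : 0 < e / 2 by rewrite divr_gt0.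
have v01 k : 0 <= v k <= 1.
  by rewrite v0 -v1 (bigD1 k)//= lerDl; apply: sumr_ge0.
have [delta delta0 [n0 H]] := operator_product_close (enum 'I_N) e2.
have : (N%:R / delta ^+ 2) * (harmonic n) @[n --> \oo] --> (0 : R).
  by rewrite -[X in _ --> X](mulr0 (N%:R / delta ^+ 2)); apply: cvgMr; exact: cvg_harmonic.
move=> /cvgr_le/(_ _ e2) small.
near=> n; rewrite distrC.
have close := @multinomial_mean_chebyshev _ _ v v0 v1 n
  (fun j => PA n (enum 'I_N) j phi x) (PB (enum 'I_N) v phi x) (e / 2) delta.
apply: (le_trans (close delta0 (ltW e2) _ _ _)).
- move=> j; have [] : test_function L (PA n (enum 'I_N) j phi); last by [].
  by apply: operator_product_test => // l psi; exact: A_test.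
- have [] : test_function L (PB (enum 'I_N) v phi); last by [].
  by apply: operator_product_test => // l psi; exact: B_test.
- move=> j jv; apply: H => //.
  by near: n; exists n0.
rewrite [e in leRHS]splitr lerD2l invfM mulrA.
by near: n.
Unshelve. all: by end_near. Qed.

End Telescoping.

(** * Independence *)

Lemma mutually_independent_reindex (R : realType) (dO : measure_display)
    (O : measurableType dO) (P : probability O R) (I I' : finType)
    (F : I -> set (set O)) (h : I' -> I) : injective h ->
  mutually_independent P F -> mutually_independent P (F \o h).
Proof.
move=> h_inj ind J E HE.
pose E' i := if [pick i' | h i' == i] is Some i' then E i' else setT.
have E'h i : E' (h i) = E i.
  by rewrite /E'; case: pickP => [i' /eqP/h_inj ->//|/(_ i)]; rewrite eqxx.
rewrite (_ : \bigcap_(i in [set` J]) E i = \bigcap_(i in [set` (h @: J)]) E' i).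
  rewrite ind; last by move=> _ /imsetP[i iJ ->]; rewrite E'h; exact: HE.
  by rewrite big_imset/=; [under eq_bigr do rewrite E'h|move=> i j _ _ /h_inj].
apply/seteqP; split => w /= H.
  by move=> _ /= /imsetP[i iJ ->]; rewrite E'h; exact: H.
by move=> i /= iJ; rewrite -E'h; apply: H => /=; apply/imsetP; exists i.
Qed.

Section Independence.
Context {R : realType} dO (O : measurableType dO) (P : probability O R).
Context d0 (T0 : measurableType d0) (N : nat).
Variables (V : O -> T0) (Z : 'I_N -> O -> R).
Hypotheses (mV : measurable_fun setT V) (mZ : forall k, measurable_fun setT (Z k)).
Hypothesis indep : mutually_independent P
  (fun i : option 'I_N => if i is Some k then sigma_generated (Z k) else sigma_generated V).

(** A pi-system generating the sigma-algebra of [V] and the [Z l] for [l] in [r].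
The family [C] is indexed by all [l], with trivial constraints off [r], so that
intersections are taken componentwise. *)
Definition cylinders (r : seq 'I_N) : set (set O) :=
  [set D | exists B C, [/\ measurable B, forall l, measurable (C l),
     forall l, l \notin r -> C l = setT &
     D = V @^-1` B `&` \bigcap_l (Z l @^-1` C l)]].

Let event B (C : 'I_N -> set R) (i : option 'I_N) : set O :=
  if i is Some l then Z l @^-1` C l else V @^-1` B.

Let event_prob B C : measurable B -> (forall l, measurable (C l)) ->
  P (V @^-1` B `&` \bigcap_l (Z l @^-1` C l)) = (\prod_i P (event B C i))%E.
Proof.
move=> mB mC.
have := @indep [set: option 'I_N]%SET (event B C).
rewrite (_ : \bigcap_(i in _) event B C i = V @^-1` B `&` \bigcap_l (Z l @^-1` C l)); last first.
  apply/seteqP; split => [w H|w [HB HC] [l|] _].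
  - split; first by apply: (H None) => /=; rewrite inE.
    by move=> l _; apply: (H (Some l)) => /=; rewrite inE.
  - exact: HC.
  - exact: HB.
move=> ->; first by apply: eq_bigl => i; rewrite inE.
move=> [l|] _ /=; rewrite /sigma_generated /preimage_set_system/=.
  by exists (C l); rewrite ?setTI.
by exists B; rewrite ?setTI.
Qed.

Lemma cylinders_indep r k (C : set R) D : k \notin r -> measurable C ->
  cylinders r D -> P (D `&` Z k @^-1` C) = (P (Z k @^-1` C) * P D)%E.
Proof.
move=> kr mC [B [C' [mB mC' C'T ->]]].
pose C2 l := if l == k then C else C' l.
have -> : V @^-1` B `&` \bigcap_l (Z l @^-1` C' l) `&` Z k @^-1` C =
    V @^-1` B `&` \bigcap_l (Z l @^-1` C2 l).
  apply/seteqP; split => w [].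
    move=> [wB wC'] wC; split => // l _; rewrite /C2/=.
    by case: eqP => [->//|_]; exact: wC'.
  move=> wB wC2; split; last by have := wC2 k Logic.I; rewrite /C2/= eqxx.
  split => // l _; have := wC2 l Logic.I; rewrite /C2/=.
  by case: eqP => [->|//]; rewrite C'T.
rewrite !event_prob//; last by move=> l; rewrite /C2; case: ifP.
rewrite (bigD1 (Some k))//= [in RHS](bigD1 (Some k))//= /C2 eqxx; congr (_ * _)%E.
rewrite C'T// preimage_setT probability_setT mul1e; apply: eq_bigr => -[l|//] /=.
by rewrite (inj_eq Some_inj) => /negbTE ->.
Qed.

Lemma cylinders_setI r : setI_closed (cylinders r).
Proof.
move=> _ _ [B [C [mB mC CT ->]]] [B' [C' [mB' mC' C'T ->]]].
exists (B `&` B'), (fun l => C l `&` C' l); split.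
- exact: measurableI.
- by move=> l; exact: measurableI.
- by move=> l lr; rewrite CT// C'T// setIT.
- apply/seteqP; split => w.
    by move=> [[wB wC] [wB' wC']]; do 2 split => //; [exact: wC|exact: wC'].
  by move=> [[wB wB'] wCC']; split; split => // l _; have [] := wCC' l Logic.I.
Qed.

Lemma cylinders_measurable r : cylinders r `<=` measurable.
Proof.
move=> _ [B [C [mB mC CT ->]]]; apply: measurableI.
  by rewrite -[X in measurable X]setTI; exact: mV.
apply: fin_bigcap_measurable => // l _.
by rewrite -[X in measurable X]setTI; exact: mZ.
Qed.

(** Both sides are measures in [D] that agree on the pi-system of cylinders. *)
Lemma generated_indep r k (C : set R) D : k \notin r -> measurable C ->
  <<s cylinders r >> D -> P (D `&` Z k @^-1` C) = (P (Z k @^-1` C) * P D)%E.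
Proof.
move=> kr mC; set p := P (Z k @^-1` C).
have mZC : measurable (Z k @^-1` C) by rewrite -[X in measurable X]setTI; exact: mZ.
have p0 : 0 <= fine p by apply: fine_ge0; exact: measure_ge0.
have pE : p = (fine p)%:E by rewrite fineK// fin_num_measure.
pose m1 : {measure set O -> \bar R} := mrestr P mZC.
pose m2 : {measure set O -> \bar R} := mscale (NngNum p0) P.
move=> HD; have := @g_sigma_algebra_measure_unique _ R O (cylinders r)
  (@cylinders_measurable r) (fun=> setT) _ _ m1 m2 (@cylinders_setI r).
rewrite /m1 /m2/= /mrestr /mscale/= -pE; apply => //.
- move=> _; exists setT, (fun=> setT); split => //.
  by rewrite preimage_setT setTI; apply/seteqP; split.
- by rewrite bigcup_const//; exists 0%N.
- by move=> A; exact: cylinders_indep.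
- by move=> _; rewrite setTI (le_lt_trans (probability_le1 P mZC))// ltry.
Qed.

End Independence.

Section WeightedSum.
Context {R : realType} dO (O : measurableType dO) (P : probability O R).
Variables (N : nat) (V : O -> N.-tuple R) (Z : 'I_N -> O -> R) (sigma : R).
Hypotheses (mV : measurable_fun setT V) (mZ : forall k, measurable_fun setT (Z k)).
Hypothesis indep : mutually_independent P
  (fun i : option 'I_N => if i is Some k then sigma_generated (Z k) else sigma_generated V).

Definition weighted_sum (r : seq 'I_N) (w : O) : R :=
  \sum_(l <- r) tnth (V w) l `^ sigma * Z l w.

(** The pair is a measurable function of [V] and of the [Z l] for [l] in [r],
which are measurable for the smaller sigma-algebra. *)
Lemma weighted_sum_generated r (A : set (N.-tuple R * R)) : measurable A ->
  <<s cylinders V Z r >> ((fun w => (V w, weighted_sum r w)) @^-1` A).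
Proof.
pose GT : measurableType _ := g_sigma_algebraType (cylinders V Z r).
pose V' : GT -> N.-tuple R := V.
pose Z' l : GT -> R := Z l.
have gV : measurable_fun setT V'.
  move=> _ B mB; rewrite setTI; apply: sub_sigma_algebra.
  exists B, (fun=> setT); split => //.
  by apply/seteqP; split => [w wB|w []].
have gZ l : l \in r -> measurable_fun setT (Z' l).
  move=> lr _ B mB; rewrite setTI; apply: sub_sigma_algebra.
  exists setT, (fun i => if i == l then B else setT); split => //.
  - by move=> i; case: ifP.
  - by move=> i; case: eqP => // ->; rewrite lr.
  rewrite preimage_setT setTI; apply/seteqP; split => w.
    by move=> wB i _ /=; case: eqP => [->|].
  by move=> /(_ l Logic.I)/=; rewrite eqxx.
move=> mA.
suff : measurable_fun setT (fun w : GT => (V' w, weighted_sum r w)).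
  by move=> /(_ measurableT _ mA); rewrite setTI.
apply: measurable_fun_pair => //.
suff : forall s, {subset s <= r} -> measurable_fun setT (fun w : GT =>
    \sum_(l <- s) tnth (V' w) l `^ sigma * Z' l w) by apply.
elim=> [|l s IH] sr.
  by under eq_fun do rewrite big_nil; exact: measurable_cst.
under eq_fun do rewrite big_cons; apply: measurable_funD; last first.
  by apply: IH => i si; apply: sr; rewrite inE si orbT.
apply: measurable_funM; last by apply: gZ; apply: sr; rewrite inE eqxx.
apply: (measurableT_comp (measurable_powR sigma)).
exact: (measurableT_comp (measurable_tnth l) gV).
Qed.

Lemma measurable_weighted_sum r : measurable_fun setT (weighted_sum r).
Proof.
apply: measurable_sum => l; apply: measurable_funM => //.
apply: (measurableT_comp (measurable_powR sigma)).
exact: (measurableT_comp (measurable_tnth l) mV).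
Qed.

Lemma weighted_sum_indep r k A (C : set R) : k \notin r ->
  measurable A -> measurable C ->
  P ((fun w => (V w, weighted_sum r w)) @^-1` A `&` Z k @^-1` C) =
  (P ((fun w => (V w, weighted_sum r w)) @^-1` A) * P (Z k @^-1` C))%E.
Proof.
move=> kr mA mC; rewrite muleC.
apply: (generated_indep mV mZ indep kr mC); exact: weighted_sum_generated.
Qed.
End WeightedSum.

Section IndependentIntegral.
Context {R : realType} dO (O : measurableType dO) (P : probability O R).
Context d1 (T1 : measurableType d1) (nu : probability R R).
Local Open Scope ereal_scope.

(** Independence, stated on events, integrates to Fubini for the joint law. *)
Lemma integral_indep (W : O -> T1) (Z : O -> R) (Phi : T1 * R -> \bar R) :
  measurable_fun setT W -> measurable_fun setT Z ->
  (forall C, measurable C -> P (Z @^-1` C) = nu C) ->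
  (forall A C, measurable A -> measurable C ->
    P (W @^-1` A `&` Z @^-1` C) = P (W @^-1` A) * P (Z @^-1` C)) ->
  measurable_fun setT Phi -> (forall z, 0 <= Phi z) ->
  \int[P]_w Phi (W w, Z w) = \int[P]_w \int[nu]_z Phi (W w, z).
Proof.
move=> mW mZ Znu indep mPhi Phi0.
pose Wm : {mfun O >-> T1} := HB.pack W (isMeasurableFun.Build _ _ _ _ W mW).
have mWZ : measurable_fun setT (fun w => (W w, Z w)) by exact: measurable_fun_pair.
pose WZm : {mfun O >-> (T1 * R)%type} :=
  HB.pack (fun w => (W w, Z w)) (isMeasurableFun.Build _ _ _ _ (fun w => (W w, Z w)) mWZ).
pose joint : probability (T1 * R)%type R := distribution P WZm.
pose m1 : probability T1 R := distribution P Wm.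
have jointE A : measurable A -> (m1 \x nu) A = joint A.
  apply: product_measure_unique => A' C mA mC.
  by have := indep A' C mA mC; rewrite Znu.
transitivity (\int[joint]_z Phi z).
  by rewrite ge0_integral_distribution.
rewrite (eq_measure_integral (m1 \x nu)); last by move=> A mA _; exact/esym/jointE.
rewrite fubini_tonelli1// /fubini_F ge0_integral_distribution//.
  exact: (measurable_fun_fubini_tonelli_F Phi).
by move=> y; apply: integral_ge0.
Qed.
End IndependentIntegral.

(** * Integrating out independent summands *)

Section Peel.
Context {R : realType} (N : nat) (sigma L : R).
Variable mu : 'I_N -> probability R R.

Definition weight_mean (k : 'I_N) (v : R) : (R -> R) -> R -> R :=
  shift_mean (mu k) (fun z => v `^ sigma * z).

(** The mean of [f] of [x] plus the sum over [r] of the [v k ^ sigma * z k], for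
independent [z k] of laws [mu k] and fixed weights [v]. *)
Definition mixture_mean (r : seq 'I_N) (f : R -> R) (v : N.-tuple R) (x : R) : R :=
  operator_product r (fun k => weight_mean k (tnth v k)) f x.

Lemma measurable_weight (v : R) : measurable_fun setT (fun z : R => v `^ sigma * z).
Proof. by apply: measurable_funM => //; exact: measurable_cst. Qed.

Lemma weight_mean_test k v phi : test_function L phi -> test_function L (weight_mean k v phi).
Proof. by move=> tphi; apply: test_function_shift_mean => //; exact: measurable_weight. Qed.

Lemma mixture_mean_test r f v : test_function L f -> test_function L (mixture_mean r f v).
Proof. by move=> tf; apply: operator_product_test => // k psi; exact: weight_mean_test. Qed.

Let shift (k : 'I_N) (q : (N.-tuple R * R) * R) : N.-tuple R * R :=
  (q.1.1, q.1.2 + tnth q.1.1 k `^ sigma * q.2).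

Let measurable_shift k : measurable_fun setT (shift k).
Proof.
have m11 : measurable_fun setT (fun q : (N.-tuple R * R) * R => q.1.1).
  by apply: measurableT_comp.
apply: measurable_fun_pair => //.
apply: measurable_funD; first by apply: measurableT_comp.
apply: measurable_funM => //.
apply: (measurableT_comp (measurable_powR sigma)).
exact: (measurableT_comp (measurable_tnth k) m11).
Qed.

Lemma mixture_mean_consE k r f v x : test_function L f ->
  (mixture_mean (k :: r) f v x)%:E =
  (\int[mu k]_z (mixture_mean r f (shift k ((v, x), z)).1 (shift k ((v, x), z)).2)%:E)%E.
Proof.
move=> tf.
transitivity (\int[mu k]_z (mixture_mean r f v (x + tnth v k `^ sigma * z)))%:E; first by [].
rewrite /Rintegral fineK//.
apply: integrable_fin_num => //; apply: bounded_measurable_integrable.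
apply: bounded_measurable_shift; last exact: measurable_weight.
exact: (mixture_mean_test r v tf).
Qed.

Lemma measurable_mixture_mean r f : test_function L f ->
  measurable_fun setT (fun p : N.-tuple R * R => mixture_mean r f p.1 p.2).
Proof.
move=> tf; elim: r => [|k r IH].
  by apply: (measurableT_comp (test_function_measurable tf)).
apply/measurable_EFinP.
rewrite [X in measurable_fun _ X](_ : _ = fubini_F (mu k) (fun q : (N.-tuple R * R) * R =>
   (mixture_mean r f (shift k q).1 (shift k q).2)%:E)); last first.
  by apply/funext => -[v x]; exact: mixture_mean_consE.
apply: measurable_fun_fubini_tonelli_F.
  by apply/measurable_EFinP; exact: (measurableT_comp IH (measurable_shift k)).
move=> [[v x] z]; rewrite lee_fin.
by have /andP[] := (mixture_mean_test r (shift k ((v, x), z)).1 tf).1 (shift k ((v, x), z)).2.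
Qed.

Context dO (O : measurableType dO) (P : probability O R).
Variables (V : O -> N.-tuple R) (Z : 'I_N -> O -> R).
Hypotheses (mV : measurable_fun setT V) (mZ : forall k, measurable_fun setT (Z k)).
Hypothesis lawZ : forall k C, measurable C -> P (Z k @^-1` C) = mu k C.
Hypothesis indep : mutually_independent P
  (fun i : option 'I_N => if i is Some k then sigma_generated (Z k) else sigma_generated V).
Local Notation sum := (weighted_sum V Z sigma).

(** The variables are integrated out one at a time: each is independent of [V]
and of those added before it. *)
Lemma integral_mixture_mean r s f : test_function L f -> uniq (r ++ s) ->
  \int[P]_w mixture_mean r f (V w) (sum s w) = \int[P]_w f (sum (catrev r s) w).
Proof.
move=> tf; elim: r s => [//|k r IH] s; rewrite cat_cons cons_uniq => /andP[krs urs].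
have ks : k \notin s by move: krs; rewrite mem_cat negb_or => /andP[].
rewrite -[RHS]/(\int[P]_w f (sum (catrev r (k :: s)) w)) -IH; last first.
  by rewrite -cat_rcons -cats1 -catA uniq_catCA/= krs.
congr fine; under eq_integral do rewrite mixture_mean_consE//.
pose W w : N.-tuple R * R := (V w, sum s w).
have mW : measurable_fun setT W.
  by apply: measurable_fun_pair => //; exact: measurable_weighted_sum.
pose Phi (q : (N.-tuple R * R) * R) : \bar R :=
  (mixture_mean r f (shift k q).1 (shift k q).2)%:E.
have mPhi : measurable_fun setT Phi.
  apply/measurable_EFinP.
  exact: (measurableT_comp (measurable_mixture_mean r tf) (measurable_shift k)).
have Phi0 q : (0 <= Phi q)%E.
  by rewrite lee_fin; have /andP[] := (mixture_mean_test r (shift k q).1 tf).1 (shift k q).2.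
have := integral_indep mW (mZ k) (@lawZ k) _ mPhi Phi0.
move=> <-; last by move=> A C mA mC; exact: weighted_sum_indep.
apply: eq_integral => w _; rewrite /Phi /shift/=; congr (mixture_mean _ _ _ _)%:E.
by rewrite /weighted_sum big_cons addrC.
Qed.

Lemma integral_weighted_sum f : test_function L f ->
  \int[P]_w f (\sum_k tnth (V w) k `^ sigma * Z k w) =
  \int[P]_w mixture_mean (enum 'I_N) f (V w) 0.
Proof.
move=> tf; have := @integral_mixture_mean (enum 'I_N) [::] f tf.
rewrite cats0 enum_uniq => /(_ isT).
under eq_Rintegral do rewrite /weighted_sum big_nil.
move=> ->; apply: eq_Rintegral => w _; congr f.
by rewrite /weighted_sum catrevE cats0 -big_enum/= [RHS]big_rev.
Qed.

End Peel.

(** * Lipschitz functions determine laws *)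

Section Ramp.
Context {R : realType}.

(** Lipschitz approximations of the indicator of the half-line up to [x]. *)
Definition ramp (n : nat) (x y : R) : R := Num.max 0 (Num.min 1 (1 - n.+1%:R * (y - x))).

Lemma test_function_ramp n x : test_function n.+1%:R (ramp n x).
Proof.
split=> [y|y z]; rewrite /ramp.
  by rewrite le_max lexx/= ge_max ler01 ge_min lexx.
have -> : n.+1%:R * `|y - z| = `|n.+1%:R * (y - x) - n.+1%:R * (z - x)|.
  by rewrite -mulrBr normrM ger0_norm// opprB addrA subrK.
move: (_ * (y - x)) (_ * (z - x)) => u t.
have := ler_norm (u - t); have := ler_norm (- (u - t)); rewrite normrN => ? ?.
rewrite ler_norml !maxEle !minEle; apply/andP.
by do 4 (case: ifP => //=); do ?[move/negbT; rewrite -ltNge => ? | move=> ?]; split; lra.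
Qed.

Lemma cvg_ramp x y : ramp n x y @[n --> \oo] --> (\1_(`]-oo, x]%classic) y : R).
Proof.
rewrite indicE; have [yx|xy] := leP y x.
  rewrite mem_set/= ?in_itv//=.
  rewrite (_ : (fun n => ramp n x y) = cst 1); first exact: cvg_cst.
  apply/funext => n; rewrite /ramp min_l ?max_r// lerBrDl gerDr.
  by rewrite mulr_ge0_le0// subr_le0.
rewrite memNset/=; last by rewrite in_itv/= leNgt xy.
apply: (cvg_near_cst).
exists (Num.truncn (y - x)^-1) => // n /=; rewrite truncn_le_nat => /ltW n_large.
apply/eqP; rewrite /ramp max_l// ge_min subr_le0; apply/orP; right.
by rewrite -ler_pdivrMr ?subr_gt0// div1r.
Qed.
End Ramp.

Section EqLaw.
Context {R : realType} d1 d2 (T1 : measurableType d1) (T2 : measurableType d2).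
Variables (P1 : probability T1 R) (P2 : probability T2 R) (X1 : T1 -> R) (X2 : T2 -> R).
Hypotheses (mX1 : measurable_fun setT X1) (mX2 : measurable_fun setT X2).

Let cvg_ramp_integral d (T : measurableType d) (P : probability T R) (X : T -> R) (x : R) :
  measurable_fun setT X ->
  \int[P]_w ramp n x (X w) @[n --> \oo] --> fine (P (X @^-1` `]-oo, x]%classic)).
Proof.
move=> mX.
have mXx : measurable (X @^-1` `]-oo, x]%classic).
  by rewrite -[X in measurable X]setTI; apply: mX => //; exact: measurable_itv.
rewrite -Rintegral_indicator//.
apply: (@bounded_convergence _ _ _ P (fun n w => ramp n x (X w)) _ 1).
- by move=> n; apply: (measurableT_comp (test_function_measurable (test_function_ramp n x))).
- exact: measurable_indic.
- by apply: aeW => w n; have /andP[r0 r1] := (test_function_ramp n x).1 (X w); rewrite ger0_norm.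
- by apply: aeW => w; exact: cvg_ramp.
Qed.

(** Letting the ramps converge, the two laws agree on half-lines, hence on
half-open intervals, which form a generating pi-system. *)
Lemma eq_law_test :
  (forall L f, 1 <= L -> test_function L f -> \int[P1]_w f (X1 w) = \int[P2]_w f (X2 w)) ->
  eq_law P1 P2 X1 X2.
Proof.
move=> eqf.
pose Y1 : {mfun T1 >-> R} := HB.pack X1 (isMeasurableFun.Build _ _ _ _ X1 mX1).
pose Y2 : {mfun T2 >-> R} := HB.pack X2 (isMeasurableFun.Build _ _ _ _ X2 mX2).
pose m1 : probability R R := distribution P1 Y1.
pose m2 : probability R R := distribution P2 Y2.
have eq_cdf x : m1 `]-oo, x]%classic = m2 `]-oo, x]%classic.
  have E : fine (P1 (X1 @^-1` `]-oo, x]%classic)) = fine (P2 (X2 @^-1` `]-oo, x]%classic)).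
    have e1 := cvg_lim (@Rhausdorff R) (@cvg_ramp_integral _ _ P1 _ x mX1).
    have e2 := cvg_lim (@Rhausdorff R) (@cvg_ramp_integral _ _ P2 _ x mX2).
    have e12 : (fun n => \int[P1]_w ramp n x (X1 w)) = (fun n => \int[P2]_w ramp n x (X2 w)).
      by apply/funext => n; apply: eqf (test_function_ramp n x); rewrite ler1n.
    by rewrite -e1 -e2 e12.
  have mx : measurable (`]-oo, x]%classic : set R) by exact: measurable_itv.
  by rewrite -[LHS](fineK (fin_num_measure m1 _ mx)) -[RHS](fineK (fin_num_measure m2 _ mx));
    congr EFin.
have itvE (m : probability R R) a b : a < b ->
    m `]a, b]%classic = (m `]-oo, b]%classic - m `]-oo, a]%classic)%E.
  move=> ab; have -> : `]a, b]%classic = `]-oo, b]%classic `\` `]-oo, a]%classic.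
    apply/seteqP; split => y /=; rewrite !in_itv/=.
      by move=> /andP[ay yb]; split => //; apply/negP; rewrite -ltNge.
    by move=> [yb /negP]; rewrite -ltNge => ->.
  rewrite measureD ?setIidr//.
    by move=> y /=; rewrite !in_itv/= => /le_trans; apply; exact: ltW.
  by rewrite -ge0_fin_numE// fin_num_measure.
suff H A : measurable A -> m1 A = m2 A by move=> A mA; exact: H.
apply: (measure_unique (@ocitv R) (fun n => `](- n%:R)%R, n%:R]%classic)).
- by [].
- exact: ocitvI.
- by move=> n; exact: is_ocitv.
- apply/seteqP; split => // x _.
  exists (Num.truncn `|x|).+1 => //=; rewrite in_itv/=.
  have := truncnS_gt `|x|; rewrite ltr_norml => /andP[-> /ltW ->]//.
- move=> B /ocitvP[->|[[a b]/= ab ->]]; first by rewrite !measure0.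
  by rewrite !itvE// !eq_cdf.
- by move=> n; rewrite (le_lt_trans (probability_le1 m1 _))// ltry.
Qed.
End EqLaw.

(** * The rescaled urn as an operator on test functions *)

Section SingleUrn.
Context {R : realType} (a b c d : nat).
Context dO (O : measurableType dO) (P : probability O R).
Variables (u0 : nat * nat) (draw : nat -> {RV P >-> bool}) (sigma L : R) (W : {RV P >-> R}).
Hypothesis urn : urn_draws a b c d u0 draw.
Hypothesis u0_gt0 : (0 < u0.1 + u0.2)%N.
Hypothesis sigma01 : 0 < sigma <= 1.
Hypothesis limW : urn_limit a b c d sigma u0 draw W.
Hypothesis L1 : 1 <= L.

Definition scaled_urn_operator (n : nat) : nat -> (R -> R) -> R -> R :=
  urn_operator a b c d (n.+1%:R `^ sigma)^-1 u0.

Let Z n j (w : O) : R := (n.+1%:R `^ sigma)^-1 * u2 a b c R (urn_process a b c d u0 draw j w).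

Let mZ n j : measurable_fun setT (Z n j).
Proof.
exact: (@measurable_urn_process R a b c d _ _ P u0 draw
  (fun u => (n.+1%:R `^ sigma)^-1 * u2 a b c R u)).
Qed.

Let mW : measurable_fun setT (W : O -> R).
Proof. exact: measurable_funP. Qed.

Let scaled_urn_operatorE n j phi : scaled_urn_operator n j phi = shift_mean P (Z n j) phi.
Proof.
by apply/funext => x; rewrite /scaled_urn_operator /urn_operator -(urn_expectation urn u0_gt0).
Qed.

Lemma scaled_urn_operator_test n j phi : test_function L phi ->
  test_function L (scaled_urn_operator n j phi).
Proof. by move=> tphi; rewrite scaled_urn_operatorE; exact: test_function_shift_mean. Qed.

Lemma scaled_urn_operator_contract n j phi psi e x : test_function L phi ->
  test_function L psi -> (forall y, `|phi y - psi y| <= e) ->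
  `|scaled_urn_operator n j phi x - scaled_urn_operator n j psi x| <= e.
Proof.
by move=> tphi tpsi H; rewrite !scaled_urn_operatorE; apply: shift_mean_contract tphi tpsi _ H.
Qed.

Lemma shift_mean_distribution v phi x : test_function L phi ->
  shift_mean (distribution P W) (fun z => v `^ sigma * z) phi x =
  shift_mean P (fun w => v `^ sigma * W w) phi x.
Proof.
move=> tphi; congr fine.
rewrite (@ge0_integral_distribution _ _ _ _ _ P W (fun z => (phi (x + v `^ sigma * z))%:E))//.
- apply/measurable_EFinP.
  apply: (bounded_measurable_shift x tphi _).1.
  by apply: measurable_funM => //; exact: measurable_cst.
- by move=> z; rewrite lee_fin; have /andP[] := tphi.1 (x + v `^ sigma * z).
Qed.

(** A bound on the truncated distance of two shifts bounds the difference of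
their convolutions on all functions with a given Lipschitz constant at once. *)
Lemma scaled_urn_operator_close e : 0 < e -> exists2 delta, 0 < delta &
  exists n0, forall n j v, (n0 <= n)%N -> 0 <= v <= 1 ->
    `|j%:R / n.+1%:R - v| <= delta -> forall phi x, test_function L phi ->
    `|scaled_urn_operator n j phi x -
      shift_mean (distribution P W) (fun z => v `^ sigma * z) phi x| <= e.
Proof.
move=> e0; have L0 : 0 < L by exact: lt_le_trans L1.
have [delta delta0 [n0 H]] := urn_limit_uniform sigma01 limW (divr_gt0 e0 L0).
exists delta => //; exists n0 => n j v n0n v01 jv phi x tphi.
rewrite scaled_urn_operatorE shift_mean_distribution//.
have mvW : measurable_fun setT (fun w => v `^ sigma * W w).
  by apply: measurable_funM => //; exact: measurable_cst.
apply: le_trans (shift_mean_dist P x tphi L1 (mZ n j) mvW) _.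
by rewrite -ler_pdivlMl// mulrC; exact: H.
Qed.

Lemma cvg_urn_mean f : test_function L f ->
  urn_mean a b c d n.+1 u0 (fun w => f ((n.+1%:R `^ sigma)^-1 * u2 a b c R w)) @[n --> \oo]
  --> \int[P]_w f (W w).
Proof.
move=> tf.
rewrite (_ : (fun n => _) = (fun n => \int[P]_w f (Z n n.+1 w))); last first.
  by apply/funext => n; rewrite -(urn_expectation urn u0_gt0).
have mf := test_function_measurable tf.
apply: (@bounded_convergence _ _ _ P (fun n w => f (Z n n.+1 w)) _ 1).
- by move=> n; apply: (measurableT_comp mf).
- exact: (measurableT_comp mf).
- by apply: aeW => w n; have /andP[f0 f1] := tf.1 (Z n n.+1 w); rewrite ger0_norm.
- apply: filterS limW => w Ww.
  have cvgZ : Z n n.+1 w @[n --> \oo] --> W w.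
    move: Ww; rewrite -(cvg_shiftS (fun n => u2 a b c R (urn_process a b c d u0 draw n w) / _)).
    rewrite (_ : [sequence _]_n = (fun n => Z n n.+1 w))//.
    by apply/funext => n; rewrite /Z mulrC.
  exact: (cvg_comp _ _ cvgZ (@test_function_continuous _ _ _ tf (W w))).
Qed.

End SingleUrn.

Section MixedMultinomial.
Context {R : realType} dO (O : measurableType dO) (P : probability O R) (N : nat).
Variable v : O -> 'I_N -> R.
Hypothesis bv : forall k, bounded_measurable (fun w => v w k).

Lemma bounded_measurable_multinomial n g :
  bounded_measurable (fun w => multinomial_mean n (v w) g).
Proof.
elim: n g => [|n IH] g /=; first exact: bounded_measurable_cst.
by apply: bounded_measurable_sum => k; exact: bounded_measurableM.
Qed.

Definition moment (j : 'I_N -> nat) : R := \int[P]_w \prod_k v w k ^+ j k.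

(** One step of the multinomial recursion multiplies the monomial by one of the
random weights. *)
Lemma integral_multinomial_mean n j g :
  moment_mean moment n j g =
  \int[P]_w ((\prod_k v w k ^+ j k) * multinomial_mean n (v w) g).
Proof.
have bmon l : bounded_measurable (fun w => \prod_k v w k ^+ l k).
  by apply: bounded_measurable_prod => k; exact: bounded_measurableX.
elim: n j g => [|n IH] j g /=.
  by rewrite RintegralZr//; exact: bounded_measurable_integrable.
under eq_bigr do rewrite IH.
rewrite -Rintegral_sum; last first.
  move=> k; apply: bounded_measurable_integrable; apply: bounded_measurableM => //.
  exact: bounded_measurable_multinomial.
apply: eq_Rintegral => w _; rewrite mulr_sumr; apply: eq_bigr => k _.
rewrite mulrA; congr (_ * _).
rewrite /incr_at; under eq_bigr do rewrite exprD.
rewrite big_split/=; congr (_ * _); rewrite (bigD1 k)//= eqxx expr1 big1 ?mulr1// => i /negbTE ->.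
by rewrite expr0.
Qed.
End MixedMultinomial.

(** * The Dirichlet vector and the distributional equations *)

Section DirichletVector.
Context {R : realType} dO (O : measurableType dO) (P : probability O R).
Variables (n : nat) (nu : 'I_n.+1 -> R) (V : {RV P >-> n.+1.-tuple R}).
Hypothesis dirV : dirichlet_law nu (distribution P V).

Lemma dirichlet_ae_simplex : {ae P, forall w, simplex (V w)}.
Proof.
have mS : measurable (~` @simplex R n.+1) by apply: measurableC; exact: measurable_simplex.
exists (V @^-1` (~` @simplex R n.+1)); split => //.
  by rewrite -[X in measurable X]setTI; exact: measurable_funP.
have [_ [C _ HC]] := dirV.
rewrite -[LHS]/(distribution P V (~` @simplex R n.+1)) HC// setICr.
rewrite [X in (_ * X)%E](_ : _ = 0%E) ?mule0// -[RHS](@lebesgue_iterated0 R n).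
by apply: eq_lebesgue_iterated => x; rewrite indic0 mul0r.
Qed.

(** [V] with the null event where it leaves the simplex cut off, so that its
coordinates are bounded everywhere. *)
Definition clipped (w : O) (k : 'I_n.+1) : R := \1_(@simplex R n.+1) (V w) * tnth (V w) k.

Lemma clippedE w k : simplex (V w) -> clipped w k = tnth (V w) k.
Proof. by move=> Vw; rewrite /clipped indicE mem_set// mul1r. Qed.

Lemma measurable_dirichlet_coord k : measurable_fun setT (fun w => tnth (V w) k).
Proof. by apply: (measurableT_comp (measurable_tnth k)); exact: measurable_funP. Qed.

Lemma bounded_measurable_clipped k : bounded_measurable (fun w => clipped w k).
Proof.
split.
  apply: measurable_funM; last exact: measurable_dirichlet_coord.
  apply: (measurableT_comp (measurable_indic _)); first exact: measurable_simplex.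
  exact: measurable_funP.
exists 1 => w; rewrite /clipped indicE; case: (boolP (V w \in _)) => [|_].
  by rewrite inE mul1r => -[/(_ k)/andP[v0 v1] _]; rewrite ger0_norm.
by rewrite mul0r normr0.
Qed.

Lemma clipped_moment_succ (j : 'I_n.+1 -> nat) k :
  (\sum_i (nu i + (j i)%:R)) * moment P clipped (incr_at k j) =
  (nu k + (j k)%:R) * moment P clipped j.
Proof.
have mE l : (\int[distribution P V]_x (\prod_i `|tnth x i| ^+ l i)%:E = (moment P clipped l)%:E)%E.
  have bmon : bounded_measurable (fun w => \prod_i clipped w i ^+ l i).
    by apply: bounded_measurable_prod => i; apply: bounded_measurableX;
      exact: bounded_measurable_clipped.
  have mabs : measurable_fun setT (fun x : n.+1.-tuple R => \prod_i `|tnth x i| ^+ l i).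
    apply: measurable_prod => i _; apply: measurable_funX.
    by apply: (measurableT_comp (@normr_measurable R setT)); exact: measurable_tnth.
  rewrite ge0_integral_distribution; last 2 first.
  - exact/measurable_EFinP.
  - by move=> x; rewrite lee_fin; apply: prodr_ge0 => i _; rewrite exprn_ge0.
  rewrite /moment fineK; last first.
    by apply: integrable_fin_num => //; exact: bounded_measurable_integrable.
  apply: ae_eq_integral => //.
  - apply: (measurableT_comp (_ : measurable_fun setT (EFin \o _))).
      exact/measurable_EFinP.
    exact: measurable_funP.
  - by apply/measurable_EFinP; case: bmon.
  apply: filterS dirichlet_ae_simplex => w Vw _ /=; congr EFin; apply: eq_bigr => i _.
  by rewrite clippedE//; case: Vw => /(_ i)/andP[v0 _] _; rewrite ger0_norm.
have := dirichlet_moment_succ j k dirV.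
by rewrite (mE j) (mE (incr_at k j)) -!EFinM => -[].
Qed.

End DirichletVector.

Section Main.
Context {R : realType} (a b c d S : nat) (sigma : R).
Hypotheses (abS : (a + b)%N = S) (cdS : (c + d)%N = S) (S_gt0 : (0 < S)%N).
Hypothesis sigma01 : 0 < sigma <= 1.
Context dX (OX : measurableType dX) (PX : probability OX R) (drawX : nat -> {RV PX >-> bool}).
Hypothesis urnX : urn_draws a b c d (1%N, 0%N) drawX.
Variable X : {RV PX >-> R}.
Hypothesis limX : urn_limit a b c d sigma (1%N, 0%N) drawX X.
Context dY (OY : measurableType dY) (PY : probability OY R) (drawY : nat -> {RV PY >-> bool}).
Hypothesis urnY : urn_draws a b c d (0%N, 1%N) drawY.
Variable Y : {RV PY >-> R}.
Hypothesis limY : urn_limit a b c d sigma (0%N, 1%N) drawY Y.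
Context dO (O : measurableType dO) (P : probability O R).
Variables (V : {RV P >-> S.+1.-tuple R}) (Xk Yk : 'I_S.+1 -> {RV P >-> R}).
Hypothesis dirV : dirichlet_law (fun _ : 'I_S.+1 => 1 / S%:R) (distribution P V).
Hypothesis copyX : forall k, eq_law P PX (Xk k) X.
Hypothesis copyY : forall k, eq_law P PY (Yk k) Y.
Hypothesis indep : mutually_independent P (sigma_family V Xk Yk).

Variable r : nat.
Hypothesis rS : (r <= S.+1)%N.

Let u (k : 'I_S.+1) : nat * nat := if (k < r)%N then (1%N, 0%N) else (0%N, 1%N).
Let Z (k : 'I_S.+1) : O -> R := if (k < r)%N then Xk k else Yk k.
Let mu (k : 'I_S.+1) : probability R R :=
  if (k < r)%N then (distribution PX X : probability R R)
  else (distribution PY Y : probability R R).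

Let mZ k : measurable_fun setT (Z k).
Proof. by rewrite /Z; case: ifP => _; exact: measurable_funP. Qed.

Let lawZ k C : measurable C -> P (Z k @^-1` C) = mu k C.
Proof. by rewrite /Z /mu => mC; case: ifP => _; [exact: copyX|exact: copyY]. Qed.

Let indepZ : mutually_independent P
  (fun i : option 'I_S.+1 => if i is Some k then sigma_generated (Z k) else sigma_generated V).
Proof.
(* Only one of the two copies is kept at each index. *)
pose h (i : option 'I_S.+1) : option ('I_S.+1 + 'I_S.+1) :=
  if i is Some k then Some (if (k < r)%N then inl k else inr k) else None.
have h_inj : injective h.
  by move=> [k|] [l|] //=; case: ifP => _; case: ifP => _ // [->].
have := mutually_independent_reindex h_inj indep.
congr mutually_independent; apply/funext => -[k|//] /=.
by rewrite /Z; case: ifP.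
Qed.

Let u_sum : ((\sum_k (u k).1)%N, (\sum_k (u k).2)%N) = (r, (S.+1 - r)%N).
Proof.
have E1 : (\sum_k (u k).1)%N = r.
  rewrite (eq_bigr (fun k : 'I_S.+1 => nat_of_bool (k < r)%N)); last first.
    by move=> k _; rewrite /u; case: ifP.
  by rewrite -big_mkcond/= -(big_ord_widen _ (fun=> 1%N) rS) sum1_card card_ord.
have E2 : (\sum_k (u k).1 + \sum_k (u k).2 = S.+1)%N.
  rewrite -big_split/= (eq_bigr (fun=> 1%N)); last by move=> k _; rewrite /u; case: ifP.
  by rewrite sum1_card card_ord.
by rewrite E1; congr pair; rewrite -[in RHS]E2 E1 addKn.
Qed.

Let weights := clipped V.

(** A sub-urn drawn [j] times has size [1 + S * j], which is [S] times the
parameter [1 / S + j] of the Dirichlet law biased by [V_k ^ j]: sizes of the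
sub-urns and moments of [V] obey the same recursion. *)
Lemma urn_mean_mixture n (s : R) f :
  urn_mean a b c d n (r, S.+1 - r)%N (fun w => f (s * u2 a b c R w)) =
  \int[P]_w multinomial_mean n (weights w) (forest_mean a b c d s f u).
Proof.
have S0 : S%:R != 0 :> R by rewrite pnatr_eq0 -lt0n.
have rec j k : (S.+1 + S * \sum_i j i)%:R * moment P weights (incr_at k j) =
    (1 + S * j k)%:R * moment P weights j.
  have E := clipped_moment_succ dirV j k.
  have -> : (S.+1 + S * \sum_i j i)%:R = S%:R * (\sum_(i < S.+1) (1 / S%:R + (j i)%:R)) :> R.
    rewrite big_split/= sumr_const card_ord -natr_sum -[_ *+ S.+1]mulr_natl natrD natrM.
    by move: S%:R S.+1%:R S0 => x y x0; field.
  have -> : (1 + S * j k)%:R = S%:R * (1 / S%:R + (j k)%:R) :> R.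
    by rewrite natrD natrM; field.
  by rewrite -mulrA E mulrA.
have u1 k : ((u k).1 + (u k).2)%N = (1 + S * 0)%N by rewrite /u; case: ifP => _; rewrite muln0.
have := @urn_mean_forest R a b c d S S.+1 abS cdS (moment P weights) s f n u (fun=> 0%N) rec u1.
rewrite u_sum.
have bw k := bounded_measurable_clipped V k.
rewrite integral_multinomial_mean//.
have one w : \prod_k weights w k ^+ 0 = 1 by apply: big1 => k _; rewrite expr0.
under [RHS]eq_Rintegral do rewrite one mul1r.
move=> <-; rewrite /moment; under eq_Rintegral do rewrite one.
by rewrite Rintegral_prob_cst mul1r.
Qed.

Lemma cvg_urn_mean_mixture L f : 1 <= L -> test_function L f ->
  urn_mean a b c d n (r, S.+1 - r)%N (fun w => f ((n.+1%:R `^ sigma)^-1 * u2 a b c R w))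
    @[n --> \oo] --> \int[P]_w f (\sum_k tnth (V w) k `^ sigma * Z k w).
Proof.
move=> L1 tf.
have mV : measurable_fun setT (V : O -> S.+1.-tuple R) by exact: measurable_funP.
rewrite (integral_weighted_sum sigma mV mZ lawZ indepZ tf).
rewrite [X in X @ _ --> _](funext (fun n => urn_mean_mixture n (n.+1%:R `^ sigma)^-1 f)).
pose A k n j := urn_operator a b c d (n.+1%:R `^ sigma)^-1 (u k) j.
pose B := weight_mean sigma mu.
have A_test k n j phi : test_function L phi -> test_function L (A k n j phi).
  rewrite /A /u; case: ifP => _ tphi.
    exact: (scaled_urn_operator_test sigma urnX isT n j tphi).
  exact: (scaled_urn_operator_test sigma urnY isT n j tphi).
have A_contract k n j phi psi e x : test_function L phi -> test_function L psi ->
    (forall y, `|phi y - psi y| <= e) -> `|A k n j phi x - A k n j psi x| <= e.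
  rewrite /A /u; case: ifP => _ tphi tpsi H.
    exact: (scaled_urn_operator_contract sigma urnX isT n j x tphi tpsi H).
  exact: (scaled_urn_operator_contract sigma urnY isT n j x tphi tpsi H).
have A_close_B k e : 0 < e -> exists2 delta, 0 < delta &
    exists n0, forall n j v, (n0 <= n)%N -> 0 <= v <= 1 ->
      `|j%:R / n.+1%:R - v| <= delta -> forall phi x, test_function L phi ->
      `|A k n j phi x - B k v phi x| <= e.
  move=> e0; rewrite /A /B /u /weight_mean /mu; case: ifP => _.
    exact: (scaled_urn_operator_close urnX isT sigma01 limX L1 e0).
  exact: (scaled_urn_operator_close urnY isT sigma01 limY L1 e0).
have B_test k v phi : test_function L phi -> test_function L (B k v phi).
  exact: weight_mean_test.
have bw k := bounded_measurable_clipped V k.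
have wE w : simplex (V w) -> weights w = tnth (V w).
  by move=> Vw; apply/funext => k; exact: clippedE.
apply: (@bounded_convergence _ _ _ P (fun n w => multinomial_mean n (weights w)
    (forest_mean a b c d (n.+1%:R `^ sigma)^-1 f u)) _ 1).
- by move=> n; exact: (bounded_measurable_multinomial bw n _).1.
- have mV0 : measurable_fun setT (fun w => (V w, 0) : S.+1.-tuple R * R).
    by apply: measurable_fun_pair => //; exact: measurable_cst.
  exact: (measurableT_comp (measurable_mixture_mean sigma mu (enum 'I_S.+1) tf) mV0).
- apply: filterS (dirichlet_ae_simplex dirV) => w Vw n.
  have [w0 w1] : (forall k, 0 <= weights w k) /\ \sum_k weights w k = 1.
    rewrite wE//; split; last by case: Vw.
    by move=> k; case: Vw => /(_ k)/andP[].
  have f01 j : 0 <= forest_mean a b c d (n.+1%:R `^ sigma)^-1 f u j <= 1.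
    have [] : test_function L (operator_product (enum 'I_S.+1) (fun k => A k n (j k)) f).
      by apply: operator_product_test => // k psi; exact: A_test.
    by move=> /(_ 0).
  have := @multinomial_mean_le _ _ _ w0 n (fun=> 0) _ (fun j => (andP (f01 j)).1).
  have := @multinomial_mean_le _ _ _ w0 n _ (fun=> 1) (fun j => (andP (f01 j)).2).
  by rewrite !multinomial_mean_cst// => ? ?; rewrite ger0_norm.
- apply: filterS (dirichlet_ae_simplex dirV) => w Vw.
  rewrite wE//; apply: (cvg_multinomial_mean A_test B_test A_contract A_close_B) => //.
    by move=> k; case: Vw => /(_ k)/andP[].
  by case: Vw.
Qed.

Lemma measurable_mixture :
  measurable_fun setT (fun w => \sum_k tnth (V w) k `^ sigma * Z k w).
Proof.
apply: measurable_sum => k; apply: measurable_funM => //.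
apply: (measurableT_comp (measurable_powR sigma)).
exact: measurable_dirichlet_coord.
Qed.

(** Both sides are limits of the same sequence of means of the urn: along the
process itself, and along its decomposition into sub-urns. *)
Lemma urn_limit_eq_law dW (OW : measurableType dW) (PW : probability OW R) u0
    (draw : nat -> {RV PW >-> bool}) (W : {RV PW >-> R}) :
  urn_draws a b c d u0 draw -> (0 < u0.1 + u0.2)%N ->
  urn_limit a b c d sigma u0 draw W ->
  (forall n (g : nat * nat -> R),
     urn_mean a b c d n.+1 u0 g = urn_mean a b c d n (r, S.+1 - r)%N g) ->
  eq_law PW P W
    (fun w => \sum_(k < S.+1 | (k < r)%N) tnth (V w) k `^ sigma * Xk k w
            + \sum_(k < S.+1 | (r <= k)%N) tnth (V w) k `^ sigma * Yk k w).
Proof.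
move=> urn u0_gt0 limW first_draw.
rewrite [X in eq_law _ _ _ X](_ : _ = fun w => \sum_k tnth (V w) k `^ sigma * Z k w); last first.
  apply/funext => w; rewrite [RHS](bigID (fun k : 'I_S.+1 => (k < r)%N))/=.
  congr (_ + _); first by apply: eq_bigr => k kr; rewrite /Z kr.
  by apply: eq_big => [k|k]; rewrite leqNgt// => /negbTE kr; rewrite /Z kr.
apply: eq_law_test => [||L f L1 tf]; first exact: measurable_funP.
  exact: measurable_mixture.
have lim1 := cvg_lim (@Rhausdorff R) (cvg_urn_mean urn u0_gt0 limW tf).
have lim2 := cvg_lim (@Rhausdorff R) (cvg_urn_mean_mixture L1 tf).
rewrite -lim1 -lim2.
by under eq_fun do rewrite first_draw.
Qed.
End Main.

Section FirstDraw.
Context {R : realType} (a b c d : nat).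

Lemma urn_mean_red n (g : nat * nat -> R) :
  urn_mean a b c d n.+1 (1%N, 0%N) g = urn_mean a b c d n (a.+1, b) g.
Proof.
rewrite -[LHS]/(1%:R / 1%:R * urn_mean a b c d n (a.+1, b) g +
  0%:R / 1%:R * urn_mean a b c d n (c.+1, d) g).
by rewrite mulr1n mulr0n !divr1 mul1r !mul0r addr0.
Qed.

Lemma urn_mean_black n (g : nat * nat -> R) :
  urn_mean a b c d n.+1 (0%N, 1%N) g = urn_mean a b c d n (c, d.+1) g.
Proof.
rewrite -[LHS]/(0%:R / 1%:R * urn_mean a b c d n (a, b.+1) g +
  1%:R / 1%:R * urn_mean a b c d n (c, d.+1) g).
by rewrite mulr1n mulr0n !divr1 mul1r !mul0r add0r.
Qed.
End FirstDraw.

Unset Implicit Arguments.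

Theorem theorem4 (R : realType) (a b c d S : nat) (sigma : R)
  (balanced1 : (a + b)%N = S) (balanced2 : (c + d)%N = S)
  (non_triangular : (b * c)%N <> 0%N)
  (sigmaE : sigma = (a%:R - c%:R) / S%:R)
  (large : 1 / 2 < sigma)
  (* X : limit of the urn started from one red ball *)
  (dX : measure_display) (OX : measurableType dX) (PX : probability OX R)
  (drawX : nat -> {RV PX >-> bool})
  (urnX : urn_draws a b c d (1%N, 0%N) drawX)
  (X : {RV PX >-> R})
  (limX : urn_limit a b c d sigma (1%N, 0%N) drawX X)
  (* Y : limit of the urn started from one black ball *)
  (dY : measure_display) (OY : measurableType dY) (PY : probability OY R)
  (drawY : nat -> {RV PY >-> bool})
  (urnY : urn_draws a b c d (0%N, 1%N) drawY)
  (Y : {RV PY >-> R})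
  (limY : urn_limit a b c d sigma (0%N, 1%N) drawY Y)
  (* the Dirichlet vector and the independent copies; the ordinal k stands for
     the index k + 1 *)
  (dO : measure_display) (O : measurableType dO) (P : probability O R)
  (V : {RV P >-> S.+1.-tuple R})
  (Xk Yk : 'I_S.+1 -> {RV P >-> R})
  (dirV : dirichlet_law (fun _ : 'I_S.+1 => 1 / S%:R) (distribution P V))
  (copyX : forall k, eq_law P PX (Xk k) X)
  (copyY : forall k, eq_law P PY (Yk k) Y)
  (indep : mutually_independent P (sigma_family V Xk Yk)) :
  eq_law PX P X
    (fun w => \sum_(k < S.+1 | (k < a.+1)%N) tnth (V w) k `^ sigma * Xk k w
            + \sum_(k < S.+1 | (a.+1 <= k)%N) tnth (V w) k `^ sigma * Yk k w)
  /\
  eq_law PY P Y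
    (fun w => \sum_(k < S.+1 | (k < c)%N) tnth (V w) k `^ sigma * Xk k w
            + \sum_(k < S.+1 | (c <= k)%N) tnth (V w) k `^ sigma * Yk k w).
Proof.
have S_gt0 : (0 < S)%N by nia.
have sigma01 : 0 < sigma <= 1.
  rewrite (lt_trans _ large) ?divr_gt0//= sigmaE ler_pdivrMr ?ltr0n// mul1r.
  by rewrite lerBlDr -natrD ler_nat; lia.
split.
- have aS : (a.+1 <= S.+1)%N by lia.
  apply: (urn_limit_eq_law balanced1 balanced2 S_gt0 sigma01 urnX limX urnY limY
    dirV copyX copyY indep aS urnX isT limX) => n g.
  by rewrite urn_mean_red (_ : (S.+1 - a.+1)%N = b)//; lia.
- have cS : (c <= S.+1)%N by lia.
  apply: (urn_limit_eq_law balanced1 balanced2 S_gt0 sigma01 urnX limX urnY limY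
    dirV copyX copyY indep cS urnY isT limY) => n g.
  by rewrite urn_mean_black (_ : (S.+1 - c)%N = d.+1)//; lia.
Qed.
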